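(* In the multi-agent setting described in the context (differentiable convex functions $f_i$, closed convex sets $H_i$, nonnegative weight matrices $\mathcal{A}(k)=[a_{ij}(k)]$ with associated graphs $\mathcal{G}(k)$, and the discrete-time algorithm given there with sample time $T>0$), suppose that the following hold: (i) for each $i\in\mathcal{I}$, the set $X_i=\{x\in\mathbb{R}^r\mid \nabla f_i(x)=0\}$ is nonempty and bounded; (ii) $H=\bigcap_{i=1}^n H_i\neq\emptyset$; (iii) there is a constant $0<\eta\le 1$ such that for all $k\ge 0$ and all $i,j\in\mathcal{I}$: $a_{ii}(k)\ge\eta$, each nonzero $a_{ij}(k)$ satisfies $a_{ij}(k)\ge\eta$, and $\mathcal{A}(k)$ is doubly stochastic, i.e. $\sum_{i=1}^n a_{ij}(k)=1$ for every $j$ and $\sum_{j=1}^n a_{ij}(k)=1$ for every $i$; (iv) there exist a positive integer $M$ and an infinite sequence $k_0,k_1,k_2,\ldots$ of switching times of the graph $\mathcal{G}(k)$ such that $k_0=0$, $0<k_{j+1}-k_j\le M$, and the union of all the graphs during each interval $[k_j,k_{j+1})$ is strongly connected, for all integers $j\ge 0$. If $0<\gamma_i<1$ for all $i\in\mathcal{I}$, then for arbitrary initial conditions $x_i(0)\in\mathbb{R}^r$ and $q_i(0)>0$, all agents reach a consensus, i.e., $\lim_{k\to+\infty}[x_i(k)-x^*(k)]=0$ for all $i\in\mathcal{I}$, where $x^*(k)=\frac1n\sum_{i=1}^n x_i(k)$, and they minimize the team objective function as $k\to+\infty$, i.e., $\lim_{k\to+\infty}\|x_i(k)-P_{\mathcal{X}}(x^*(k))\|=0$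 for all $i\in\mathcal{I}$, where $\mathcal{X}$ is the set of minimizers of $\sum_{i=1}^n f_i(s)$ over $s\in H$.
   Context: Let $\mathcal{I}=\{1,\ldots,n\}$ index $n$ agents. For each $i\in\mathcal{I}$, $f_i:\mathbb{R}^r\to\mathbb{R}$ is a differentiable convex function and $H_i\subseteq\mathbb{R}^r$ is a closed convex set. $\|\cdot\|$ is the Euclidean norm, and for a nonempty closed convex set $K$, $P_K(s)=\arg\min_{\bar s\in K}\|s-\bar s\|$ is the Euclidean projection onto $K$. The optimization problem is: minimize $\sum_{i=1}^n f_i(s)$ subject to $s\in H=\bigcap_{i=1}^n H_i$ (equivalently, minimize $\sum_{i=1}^n f_i(x_i)$ subject to $x_i=x_j\in H$ for all $i,j$). Its optimal set is denoted $\mathcal{X}$; under hypotheses (i) and (ii) of the claim, $\mathcal{X}$ is known to be a nonempty closed bounded convex set. Graphs. For each integer $k\ge 0$, $\mathcal{A}(k)=[a_{ij}(k)]\in\mathbb{R}^{n\times n}$ is a matrix with nonnegative entries. $\mathcal{G}(k)$ is the directed graph on $\mathcal{I}$ in which, for $i\ne j$, $(j,i)$ is an edge if and only if $a_{ij}(k)>0$; the neighbor set of agent $i$ is $N_i(k)=\{j\in\mathcal{I}\mid j\neq i,\ a_{ij}(k)>0\}$. A graph is strongly connected if there is a directed path from every agent to every other agent. The union of a family of graphs is the graph on $\mathcal{I}$ whose edge set is the union of their edge sets. Algorithm. Let $T>0$ be the sample time and $0<\gamma_i\le 1$ a constant for each $i$; the time argument $k$ stands for $kT$. For all $i\in\mathcal{I}$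 and integers $k\ge 0$, $x_i(k+1)=u_i(k)\in\mathbb{R}^r$, where $$q_i(k+1)=q_i(k)+\arctan\big(e^{\|x_i(k)\|}\big)T,\quad q_i(0)>0,$$ $$u_i(k)=(1-\gamma_i)w_i(k)+\gamma_i P_{H_i}[w_i(k)],\qquad w_i(k)=v_i(k)-gr_i(k)T,\qquad v_i(k)=\sum_{j\in N_i(k)\cup\{i\}}a_{ij}(k)x_j(k),$$ $$gr_i(k)=\begin{cases}0, & \text{if } \sqrt{q_i(k)}\le\|\nabla f_i(v_i(k))\|^2,\\[2pt] \dfrac{\nabla f_i(v_i(k))}{\sqrt{q_i(k)}}, & \text{otherwise.}\end{cases}$$ *)

(* Defs.v *)
From HB Require Import structures.
From mathcomp Require Import all_boot all_order all_algebra.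
From mathcomp Require Import all_classical all_reals all_analysis.

Set Implicit Arguments.
Unset Strict Implicit.
Unset Printing Implicit Defensive.

Import Order.TTheory GRing.Theory Num.Theory.
Import numFieldNormedType.Exports.

Local Open Scope classical_set_scope.
Local Open Scope ring_scope.

(* The library norm `|x| on 'rV[R]_r is the sup norm. It induces the same
   topology, differentiability and bounded sets as the Euclidean norm, so it is
   kept for those notions; every quantitative norm below is [enorm]. *)
Definition enorm (R : realType) (r : nat) (x : 'rV[R]_r) : R :=
  Num.sqrt (\sum_(j < r) x 0 j ^+ 2).

Definition grad (R : realType) (r : nat) (f : 'rV[R]_r -> R) (p : 'rV[R]_r) :
    'rV[R]_r :=
  \row_(j < r) 'D_(delta_mx 0 j) f p.

Definition minimizers (R : realType) (S : Type) (F : S -> R) (K : set S) :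
    set S :=
  [set s | K s /\ forall t, K t -> F s <= F t].

(* A junk value (0) is returned when the minimum is not attained; for K
   nonempty, closed and convex the minimizer exists and is unique. *)
Definition nearest_point (R : realType) (r : nat) (K : set 'rV[R]_r) (s : 'rV[R]_r) :
    'rV[R]_r :=
  xget 0 (minimizers (fun t => enorm (s - t)) K).

(* [digraph A j i] says that (j, i) is an edge, from j to i. *)
Definition digraph (R : realType) (n : nat) (A : 'M[R]_n) : rel 'I_n :=
  fun j i => (i != j) && (0 < A i j).

Definition neighbors (R : realType) (n : nat) (A : 'M[R]_n) (i : 'I_n) :
    {set 'I_n} :=
  [set j | digraph A j i].

Definition union_graph (n : nat) (G : nat -> rel 'I_n) (s t : nat) :
    rel 'I_n :=
  fun i j => has (fun k => G k i j) (index_iota s t).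

Definition strongly_connected (n : nat) (e : rel 'I_n) : Prop :=
  forall i j, connect e i j.

Section Algorithm.
Context (R : realType) (n r : nat).
Variables (f : 'I_n -> 'rV[R]_r -> R) (H : 'I_n -> set 'rV[R]_r).
Variables (T : R) (gamma : 'I_n -> R) (A : 'M[R]_n).
Implicit Types (x : 'I_n -> 'rV[R]_r) (q : 'I_n -> R).

Definition mix x (i : 'I_n) : 'rV[R]_r :=
  \sum_(j in i |: neighbors A i) A i j *: x j.

Definition switched_grad x q (i : 'I_n) : 'rV[R]_r :=
  let g := grad (f i) (mix x i) in
  if Num.sqrt (q i) <= enorm g ^+ 2 then 0 else (Num.sqrt (q i))^-1 *: g.

Definition grad_step x q (i : 'I_n) : 'rV[R]_r :=
  mix x i - T *: switched_grad x q i.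

Definition next_x x q (i : 'I_n) : 'rV[R]_r :=
  (1 - gamma i) *: grad_step x q i + gamma i *: nearest_point (H i) (grad_step x q i).

Definition next_q x q (i : 'I_n) : R := q i + atan (expR (enorm (x i))) * T.

End Algorithm.

Definition average (R : realType) (n r : nat) (x : 'I_n -> 'rV[R]_r) :
    'rV[R]_r :=
  n%:R^-1 *: \sum_(i < n) x i.

(* Main.v *)
Require Import Defs.
From mathcomp Require Import all_boot all_order all_algebra.
From mathcomp Require Import all_classical all_reals all_analysis.
From mathcomp Require Import ring lra.

Import Order.TTheory GRing.Theory Num.Theory.
Import numFieldNormedType.Exports.

Local Open Scope classical_set_scope.
Local Open Scope ring_scope.
Set Implicit Arguments.
Unset Strict Implicit.
Unset Printing Implicit Defensive.

(** The theorem is a Lyapunov argument for the functions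
    V_z(k) = sum_i |x_i(k) - z|^2, with z in the intersection of the H_i.

    One step of the algorithm satisfies (lemma [total_next_le])
      V_z(k+1) <= V_z(k) - sum_i (sum_j a_ij |x_j - v_i|^2
                                   + gamma_i |w_i - P_i w_i|^2)
                   + sum_i (T^2 al_i^2 |g_i|^2 - 2 T al_i (f_i(v_i) - f_i(z))),
    where g_i is the gradient of f_i at v_i and al_i is either 0 or
    1 / sqrt(q_i).  Double stochasticity makes the mixing lose exactly a
    variance, and projections and the gradient inequality give the rest.  The
    steps al_i tend to 0 but are not square summable, so the usual summability
    arguments are not available.  What is available is [descent_cvg0]: a
    nonnegative sequence whose increments have a vanishing upper bound, and
    which loses a divergent amount as long as it stays away from 0, tends to 0.
    It is applied twice, with z renewed each time as the projection of the
    average of the agents onto a convex set, because that projection minimizes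
    V_z over the set, so that renewing z never increases the Lyapunov function.

    Boundedness ([trajectory_bounded]).  The switch in the algorithm forces
    al_i^2 |g_i|^2 <= al_i, whatever the size of the gradient, and every f_i is
    coercive because a convex function with a bounded nonempty set of
    minimizers grows at least linearly ([convex_coercive]).  Far away the
    gradient step therefore does not increase the distance to z, and nearby it
    moves by a bounded amount.

    Consensus and feasibility ([spread_cvg0]).  The Lyapunov function is V at
    the projection of the average onto the intersection of the H_i, sampled at
    the switching times.  If it loses little over one window, then all agents
    stay almost still, neighbours almost agree, every agent is almost in its
    own set, and by strong connectivity of the union graph all agents almost
    agree.  Their average is then close to every H_i, hence, by compactness
    ([near_bigcap]), close to the intersection: the Lyapunov function itself is
    small ([small_dissipation]).

    Optimality ([spread_X_cvg0]).  Consensus makes the increments of the q_i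
    asymptotically equal, so that by Cesaro's lemma all steps al_i are
    asymptotically equal to one common step ([step_ratio_cvg1]).  The sum of
    the gradient terms is then that common step times
    - 2T (F(average) - min F) + o(1) ([optimal_descent]).  When the average is
    far from the optimal set but almost feasible, F(average) - min F is bounded
    below by compactness ([near_minimizers]).  The common step is of order
    1 / sqrt k and has a divergent sum, so V at the projection of the average
    onto the optimal set tends to 0. *)

(** * Euclidean geometry of row vectors *)

Definition dot (R : realType) (r : nat) (u v : 'rV[R]_r) : R :=
  \sum_(j < r) u 0 j * v 0 j.

Lemma cvg_sum (R : realType) (S : Type) {F : set_system S} {FF : Filter F}
    (I : Type) (s : seq I) (f : I -> S -> R) (l : I -> R) :
  (forall i, f i t @[t --> F] --> l i) ->
  \sum_(i <- s) f i t @[t --> F] --> \sum_(i <- s) l i.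
Proof.
move=> fl; elim: s => [|i s IH].
  by under eq_fun do rewrite big_nil; rewrite big_nil; exact: cvg_cst.
by under eq_fun do rewrite big_cons; rewrite big_cons; apply: cvgD.
Qed.

Section Euclidean.
Context (R : realType) (r : nat).
Implicit Types (u v w z : 'rV[R]_r) (a : R) (K : set 'rV[R]_r).

Lemma dotC u v : dot u v = dot v u.
Proof. by apply: eq_bigr => j _; rewrite mulrC. Qed.

Lemma dotDl u v w : dot (u + v) w = dot u w + dot v w.
Proof. by rewrite -big_split; apply: eq_bigr => j _; rewrite !mxE mulrDl. Qed.

Lemma dotZl a u w : dot (a *: u) w = a * dot u w.
Proof. by rewrite /dot mulr_sumr; apply: eq_bigr => j _; rewrite !mxE mulrA. Qed.

Lemma dotNl u w : dot (- u) w = - dot u w.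
Proof. by rewrite -scaleN1r dotZl mulN1r. Qed.

Lemma dotDr u v w : dot w (u + v) = dot w u + dot w v.
Proof. by rewrite dotC dotDl !(dotC w). Qed.

Lemma dotZr a u w : dot w (a *: u) = a * dot w u.
Proof. by rewrite dotC dotZl (dotC w). Qed.

Lemma dotNr u w : dot w (- u) = - dot w u.
Proof. by rewrite dotC dotNl (dotC w). Qed.

Definition dotE := (dotDl, dotDr, dotNl, dotNr, dotZl, dotZr).

Lemma dot0l u : dot 0 u = 0.
Proof. by rewrite -(scale0r 0) dotZl mul0r. Qed.

Lemma dot_suml (I : Type) (s : seq I) (P : pred I) (F : I -> 'rV[R]_r) u :
  dot (\sum_(i <- s | P i) F i) u = \sum_(i <- s | P i) dot (F i) u.
Proof.
by apply: (big_morph (fun v => dot v u)) => [v w|]; rewrite ?dotDl ?dot0l.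
Qed.

Lemma dot_ge0 u : 0 <= dot u u.
Proof. by apply: sumr_ge0 => j _; rewrite -expr2 sqr_ge0. Qed.

Lemma enormE u : enorm u = Num.sqrt (dot u u).
Proof. by congr Num.sqrt; apply: eq_bigr => j _; rewrite expr2. Qed.

Lemma enorm_ge0 u : 0 <= enorm u.
Proof. exact: sqrtr_ge0. Qed.

Lemma sqr_enorm u : enorm u ^+ 2 = dot u u.
Proof. by rewrite enormE sqr_sqrtr// dot_ge0. Qed.

Lemma enorm_le u a : 0 <= a -> (enorm u <= a) = (dot u u <= a ^+ 2).
Proof.
by move=> a0; rewrite -sqr_enorm ler_sqr// ?nnegrE ?enorm_ge0.
Qed.

Lemma dot_subZ u v a :
  dot (u - a *: v) (u - a *: v) = dot u u - 2 * a * dot u v + a ^+ 2 * dot v v.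
Proof. by rewrite !dotE (dotC v u); ring. Qed.

(** The square of the norm of [(v.v) u - (u.v) v] is nonnegative. When [v.v]
    vanishes this says nothing, and a large multiple of [v] is subtracted from
    [u] instead. *)
Lemma cauchy_schwarz u v : `|dot u v| <= enorm u * enorm v.
Proof.
rewrite -ler_sqr ?nnegrE ?mulr_ge0 ?enorm_ge0// real_normK ?num_real//.
rewrite exprMn !sqr_enorm.
have := dot_ge0 (dot v v *: u - dot u v *: v).
rewrite !dotE (dotC v u) => h.
have {h} : 0 <= dot v v * (dot u u * dot v v - dot u v ^+ 2) by lra.
have [v0|v0] := ltP 0 (dot v v); first by rewrite pmulr_rge0// subr_ge0.
have v00 : dot v v = 0 by apply/eqP; rewrite eq_le v0 dot_ge0.
move=> _; rewrite v00 mulr0 leNgt; apply/negP => uv0.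
have := dot_ge0 (u - ((dot u u + 1) / dot u v) *: v).
have uv_neq0 : dot u v != 0 by rewrite -sqrf_eq0 gt_eqF.
rewrite !dotE (dotC v u) v00 !mulr0 divfK//.
have := dot_ge0 u; lra.
Qed.

Lemma enormD u v : enorm (u + v) <= enorm u + enorm v.
Proof.
rewrite enorm_le ?addr_ge0 ?enorm_ge0// !dotE (dotC v u) sqrrD !sqr_enorm.
have := le_trans (ler_norm _) (cauchy_schwarz u v); lra.
Qed.

Lemma enormN u : enorm (- u) = enorm u.
Proof. by rewrite !enormE !dotE opprK. Qed.

Lemma enormB u v : enorm (u - v) = enorm (v - u).
Proof. by rewrite -enormN opprB. Qed.

Lemma enormZ a u : enorm (a *: u) = `|a| * enorm u.
Proof.
by rewrite !enormE !dotE mulrA -expr2 sqrtrM ?sqr_ge0// sqrtr_sqr.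
Qed.

Lemma enorm_trans v u w : enorm (u - w) <= enorm (u - v) + enorm (v - w).
Proof. by rewrite -[u - w](subrKA v) enormD. Qed.

Lemma enorm_dist u v : `|enorm u - enorm v| <= enorm (u - v).
Proof.
rewrite ler_norml; have := enormD (u - v) v; have := enormD (v - u) u.
by rewrite !subrK (enormB v u); lra.
Qed.

(** Openness, compactness and continuity come with the sup norm; this lemma and
    the next transfer them to the Euclidean one. *)
Lemma le_norm_enorm u : `|u| <= enorm u.
Proof.
rewrite [leLHS]mx_normrE; apply/bigmax_leP; split; first exact: enorm_ge0.
move=> [i j] _ /=; rewrite -ler_sqr ?nnegrE ?enorm_ge0// real_normK ?num_real//.
rewrite ord1 sqr_enorm /dot (bigD1 j)//= -expr2 lerDl.
by apply: sumr_ge0 => k _; rewrite -expr2 sqr_ge0.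
Qed.

Lemma le_enorm_norm u : enorm u <= r%:R * `|u|.
Proof.
rewrite enorm_le ?mulr_ge0// exprMn.
apply: (@le_trans _ _ (\sum_(j < r) `|u| ^+ 2)).
  apply: ler_sum => j _; rewrite -expr2 -[leLHS]real_normK ?num_real//.
  rewrite ler_sqr ?nnegrE// [leRHS]mx_normrE.
  by apply/bigmax_geP; right; exists (0, j).
rewrite sumr_const card_ord -[leLHS]mulr_natl ler_wpM2r ?sqr_ge0// expr2.
by case: (r) => [|k]; rewrite ?mul0r// ler_peMl ?ler0n ?ler1n.
Qed.

Lemma enorm_eq0 u : enorm u = 0 -> u = 0.
Proof.
by move=> u0; apply/eqP; rewrite -normr_le0 -u0; exact: le_norm_enorm.
Qed.

Lemma enorm_continuous : continuous (@enorm R r).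
Proof.
move=> u; apply: (@continuous_comp _ _ _ _ (@Num.sqrt R)).
  apply: (cvg_sum (F := nbhs u)) => j /=.
  under [X in X @ _]eq_fun do rewrite expr2.
  by rewrite expr2; apply: cvgM; exact: coord_continuous.
exact: sqrt_continuous.
Qed.

Lemma continuous_edist z : continuous (fun p : 'rV[R]_r => enorm (p - z)).
Proof.
move=> p; apply: (@continuous_comp _ _ _ (fun p : 'rV[R]_r => p - z) _ p);
  last exact: enorm_continuous.
by apply: (@continuousB _ _ _ id (fun=> z)); [exact: id|exact: cst_continuous].
Qed.

Lemma closed_eball z a : closed [set p | enorm (p - z) <= a].
Proof.
have c : {in ~` (fun p => enorm (p - z)) @^-1` [set t | t <= a],
    continuous (fun p : 'rV[R]_r => enorm (p - z))}.
  by move=> p _; exact: continuous_edist.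
exact: (preimage_closed c (@closed_le _ a)).
Qed.

Lemma compact_eball z a : compact [set p | enorm (p - z) <= a].
Proof.
suff bd : bounded_set [set p | enorm (p - z) <= a].
  exact: (bounded_closed_compact bd (@closed_eball z a)).
exists (a + `|z|); split; first exact: num_real.
move=> b hb p /= hp; apply: le_trans (ltW hb).
rewrite -[p](subrK z) (le_trans (ler_normD _ _))// lerD2r.
exact: le_trans (le_norm_enorm _) hp.
Qed.

Lemma near_eball u a : 0 < a -> \forall p \near u, enorm (p - u) < a.
Proof.
move=> a0; have := @continuous_edist u u.
by rewrite /continuous_at subrr enormE dot0l sqrtr0 => /cvgr_lt; exact.
Qed.

End Euclidean.

(** * Projections and differentiable convex functions *)

Section Convexity.
Context (R : realType) (r : nat).
Implicit Types (u v w z : 'rV[R]_r) (a t : R) (K : set 'rV[R]_r).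
Implicit Types f : 'rV[R]_r -> R.

Lemma convex_setE K u v t : convex_set K -> K u -> K v -> 0 <= t -> t <= 1 ->
  K (t *: u + (1 - t) *: v).
Proof.
move=> cK Ku Kv t0 t1.
by have := cK u v (Itv01 t0 t1); rewrite !inE; exact.
Qed.

Lemma convex_functionE f u v t : convex_function [set: 'rV[R]_r] f ->
  0 <= t -> t <= 1 -> f (t *: u + (1 - t) *: v) <= t * f u + (1 - t) * f v.
Proof.
move=> cf t0 t1.
by have := cf (Itv01 t0 t1) u v; rewrite !inE; exact.
Qed.

Lemma nearest_pointP K w : closed K -> K !=set0 ->
  minimizers (fun p : 'rV[R]_r => enorm (w - p)) K (nearest_point K w).
Proof.
move=> clK [z0 Kz0]; apply: xgetPex.
pose C := [set p | enorm (p - w) <= enorm (z0 - w)] `&` K.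
have cC : compact C.
  exact: compact_closedI (@compact_eball _ _ w (enorm (z0 - w))) clK.
have [||p] := @EVT_min_rV R r (fun p => enorm (p - w)) C _ cC.
- by exists z0; split => /=.
- by apply: continuous_subspaceT => p; exact: continuous_edist.
rewrite inE => -[pw Kp] pmin; exists p; split => // t Kt.
rewrite !(enormB w).
have [tw|/ltW tw] := leP (enorm (t - w)) (enorm (z0 - w)).
  by apply: pmin; rewrite inE; split.
exact: le_trans pw tw.
Qed.

(** Otherwise a short move from the nearest point [p] towards [z] would stay in
    [K] and come closer to [w]. *)
Lemma nearest_point_obtuse K w z : closed K -> convex_set K -> K z ->
  dot (w - nearest_point K w) (z - nearest_point K w) <= 0.
Proof.
move=> clK cK Kz; have [Kp] := @nearest_pointP K w clK (ex_intro _ z Kz).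
set p := nearest_point K w in Kp * => pmin.
set d := dot _ _; rewrite leNgt; apply/negP => d0.
set m := dot (z - p) (z - p).
have m0 : 0 <= m by exact: dot_ge0.
have dm0 : 0 < d + m by lra.
(* The squared distance changes by [- 2 t d + t ^+ 2 m] along the segment; this
   [t] is at most 1 and makes the change negative. *)
set t := d / (d + m).
have t0 : 0 < t by rewrite divr_gt0.
have t1 : t <= 1 by rewrite ler_pdivrMr//; lra.
have := pmin _ (convex_setE cK Kz Kp (ltW t0) t1).
rewrite enorm_le ?enorm_ge0// sqr_enorm.
have -> : w - (t *: z + (1 - t) *: p) = (w - p) - t *: (z - p).
  by apply/rowP => j; rewrite !mxE; ring.
rewrite dot_subZ -/d -/m.
have : t * (d + m) = d by rewrite divfK// gt_eqF.
nra.
Qed.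

(** The strict gain [a * enorm (w - p) ^+ 2] is what forces the agents into
    their sets. With [u] the relaxed point, [u - z = (w - z) - a (w - p)], and the
    obtuse angle gives [(w - z).(w - p) >= |w - p|^2]. *)
Lemma relaxed_projection_le K w z a : closed K -> convex_set K -> K z ->
  0 <= a -> a <= 1 ->
  enorm ((1 - a) *: w + a *: nearest_point K w - z) ^+ 2
    <= enorm (w - z) ^+ 2 - a * enorm (w - nearest_point K w) ^+ 2.
Proof.
move=> clK cK Kz a0 a1; rewrite !sqr_enorm.
set p := nearest_point K w; set u := _ + a *: p.
have := @nearest_point_obtuse K w z clK cK Kz; rewrite -/p => h.
have -> : u - z = (w - z) - a *: (w - p).
  by apply/rowP => j; rewrite !mxE; ring.
rewrite dot_subZ.
have : dot (w - p) (w - p) <= dot (w - z) (w - p).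
  rewrite -subr_ge0 -dotNl -dotDl. 
  suff -> : w - z - (w - p) = - (z - p) by rewrite dotNl dotC oppr_ge0.
  by apply/rowP => j; rewrite !mxE; ring.
set D := dot (w - z) (w - p); set N := dot (w - p) (w - p) => ND.
have N0 : 0 <= N by exact: dot_ge0.
have := mulr_ge0 (mulr_ge0 a0 N0) (etrans (subr_ge0 a 1) a1).
have : 0 <= a * (D - N) by rewrite mulr_ge0// subr_ge0.
lra.
Qed.

Lemma derive_grad f p v : differentiable f p -> 'D_v f p = dot (grad f p) v.
Proof.
move=> df; rewrite deriveE// [in LHS](row_sum_delta v) linear_sum.
by apply: eq_bigr => j _; rewrite mxE deriveE// linearZ/= mulrC.
Qed.

(** Convexity and minimality only control difference quotients with a positive
    increment, whence the one-sided limit. *)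
Lemma difference_quotient_cvg f p v : differentiable f p ->
  t^-1 * (f (p + t *: v) - f p) @[t --> 0^'+] --> dot (grad f p) v.
Proof.
move=> df; rewrite -derive_grad//.
have /cvg_ex[l fl] : derivable f p v by exact: diff_derivable.
have -> : 'D_v f p = l by apply: cvg_lim fl.
apply: cvg_trans fl; under eq_fun do rewrite [p + _]addrC.
apply: cvg_app => A [e e0 eA].
by exists e => //= t te t0; apply: eA => //=; rewrite gt_eqF.
Qed.

Lemma convex_gradient_le f p u : differentiable f p ->
  convex_function [set: 'rV[R]_r] f -> f p + dot (grad f p) (u - p) <= f u.
Proof.
move=> df cf; rewrite -lerBrDl.
apply: (cvgr_to_le (difference_quotient_cvg (v := u - p) df)); near=> t.
have t0 : 0 < t by near: t; exact: nbhs_right_gt.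
have t1 : t <= 1 by near: t; exact: nbhs_right_le.
rewrite ler_pdivrMl//.
have := convex_functionE u p cf (ltW t0) t1.
suff -> : p + t *: (u - p) = t *: u + (1 - t) *: p by lra.
by apply/rowP => j; rewrite !mxE; ring.
Unshelve. all: by end_near. Qed.

Lemma grad_minimizer f p : differentiable f p -> (forall u, f p <= f u) ->
  grad f p = 0.
Proof.
move=> df pmin; apply: enorm_eq0; apply/eqP.
rewrite -sqrf_eq0 sqr_enorm eq_le dot_ge0 andbT -oppr_ge0 -dotNr.
apply: (cvgr_to_ge (difference_quotient_cvg (v := - grad f p) df)); near=> t.
have t0 : 0 < t by near: t; exact: nbhs_right_gt.
by rewrite mulr_ge0 ?invr_ge0 ?(ltW t0)// subr_ge0.
Unshelve. all: by end_near. Qed.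

Lemma bounded_enorm (K : set 'rV[R]_r) z : bounded_set K ->
  exists2 b, 0 < b & forall p, K p -> enorm (p - z) <= b.
Proof.
move=> [M [_ bK]]; pose b := r%:R * (`|M| + 1) + enorm z + 1.
have b0 : 0 < b.
  by rewrite ltr_wpDl// addr_ge0 ?enorm_ge0// mulr_ge0// addr_ge0.
exists b => // p /(bK (`|M| + 1)).
have -> : M < `|M| + 1 by rewrite (le_lt_trans (ler_norm M))// ltrDl.
move=> /(_ isT) pM; rewrite (le_trans (enormD p (- z)))// enormN.
rewrite /b -addrA lerD//; last by rewrite lerDl.
by rewrite (le_trans (le_enorm_norm p))// ler_wpM2l.
Qed.

(** On a sphere around a minimizer [p0] that encloses all critical points, [f]
    exceeds [f p0] by some [c > 0], by compactness. Convexity along rays from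
    [p0] makes this excess grow at least linearly. *)
Lemma convex_coercive f z a : (forall p, differentiable f p) ->
  convex_function [set: 'rV[R]_r] f ->
  [set p | grad f p = 0] !=set0 -> bounded_set [set p | grad f p = 0] ->
  exists2 b, 0 < b & forall v, b <= enorm (v - z) -> a <= f v.
Proof.
move=> df cf [p0 /= gp0] bd.
have p0min u : f p0 <= f u.
  by have := convex_gradient_le u (df p0) cf; rewrite gp0 dot0l addr0.
have [b0 b00 crit_b0] := bounded_enorm p0 bd.
pose b := b0 + 1; have b_gt0 : 0 < b by rewrite addr_gt0.
pose S := [set p | enorm (p - p0) = b].
have cS : compact S.
  apply: (@subclosed_compact _ S [set p | enorm (p - p0) <= b]).
  - have c : {in ~` (fun p => enorm (p - p0)) @^-1` [set t | t = b],
        continuous (fun p : 'rV[R]_r => enorm (p - p0))}.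
      by move=> p _; exact: continuous_edist.
    exact: (preimage_closed c (@closed_eq _ b)).
  - exact: compact_eball.
  - by move=> p /= ->.
have [c c0 fS] : exists2 c, 0 < c & forall p, S p -> f p0 + c <= f p.
  have [S0|] := pselect (S !=set0); last first.
    by move=> S0; exists 1 => // p Sp; case: S0; exists p.
  have [|p pS pmin] := EVT_min_rV S0 cS (f := f).
    by apply: continuous_subspaceT => p; exact: differentiable_continuous.
  rewrite inE in pS; exists (f p - f p0); last first.
    by move=> t St; rewrite subrKC; apply: pmin; rewrite inE.
  rewrite subr_gt0 ltNge; apply/negP => fpp0.
  have /crit_b0 : [set p | grad f p = 0] p.
    by apply: grad_minimizer => // u; exact: le_trans fpp0 (p0min u).
  by rewrite pS /b gerDl ler10.
exists (b + enorm (p0 - z) + b * `|a - f p0| / c).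
  by rewrite ltr_pwDl ?ltr_pwDl ?enorm_ge0// divr_ge0 ?mulr_ge0// ltW.
move=> v vz; set d := enorm (v - p0).
have d_ge : b + b * `|a - f p0| / c <= d.
  by have := enorm_trans p0 v z; rewrite -/d; move: vz; lra.
have bc0 : 0 <= b * `|a - f p0| / c by rewrite divr_ge0 ?mulr_ge0// ltW.
have d0 : 0 < d by rewrite (lt_le_trans _ d_ge)// ltr_pwDl.
have t0 : 0 < b / d by rewrite divr_gt0.
have t1 : b / d <= 1 by rewrite ler_pdivrMr// mul1r (le_trans _ d_ge)// lerDl.
have /fS : S ((b / d) *: v + (1 - b / d) *: p0).
  rewrite /S/= (_ : _ - _ = (b / d) *: (v - p0)).
    by rewrite enormZ gtr0_norm// -/d divfK// gt_eqF.
  by apply/rowP => j; rewrite !mxE; ring.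
have := convex_functionE v p0 cf (ltW t0) t1 => h1 h2.
have : f p0 + c <= b / d * f v + (1 - b / d) * f p0 by exact: le_trans h2 h1.
have -> : b / d * f v + (1 - b / d) * f p0 = f p0 + b * (f v - f p0) / d.
  by field; rewrite gt_eqF.
rewrite lerD2l ler_pdivlMr// => h.
suff : `|a - f p0| <= f v - f p0 by have := ler_norm (a - f p0); lra.
rewrite -(ler_pM2l b_gt0); apply: le_trans h.
by rewrite -ler_pdivrMl// mulrC (le_trans _ d_ge)// lerDr ltW.
Qed.

End Convexity.

(** * Compactness in place of error bounds *)

Section Compactness.
Context (R : realType) (r : nat).
Implicit Types (p s z : 'rV[R]_r) (b e rho : R) (K : set 'rV[R]_r).

(** A property that holds locally for all small enough tolerances holds on a
    whole ball for one tolerance: the finite covering argument behind the two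
    lemmas [near_bigcap] and [near_minimizers]. *)
Lemma eball_uniform z b (P : R -> 'rV[R]_r -> Prop) :
  (forall x, enorm (x - z) <= b -> exists2 e, 0 < e &
     forall p rho, enorm (p - x) < e -> 0 < rho < e -> P rho p) ->
  exists2 rho, 0 < rho & forall p, enorm (p - z) <= b -> P rho p.
Proof.
move=> locP.
have /compact_near_coveringP cover := @compact_eball R r z b.
have : \forall rho \near 0^'+, [set p | enorm (p - z) <= b] `<=` P rho.
  apply: cover => x /locP[e e0 eP].
  exists ([set p | enorm (p - x) < e], [set rho | 0 < rho < e]) => /=.
    split; first exact: near_eball.
    near=> rho; apply/andP; split; first by near: rho; exact: nbhs_right_gt.
    by near: rho; exact: nbhs_right_lt.
  by move=> [p rho] /= [px rhoe]; exact: eP.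
move=> nP; have [rho [rho0 rhoP]] : exists rho, 0 < rho /\
    [set p | enorm (p - z) <= b] `<=` P rho.
  apply: (@filter_ex _ (0^'+ : set_system R)); near=> rho; split.
    by near: rho; exact: nbhs_right_gt.
  by near: rho.
by exists rho.
Unshelve. all: by end_near. Qed.

Lemma eball_off_closed K x : closed K -> ~ K x ->
  exists2 e, 0 < e & forall p s rho, K s -> enorm (p - x) < e ->
    rho < e -> enorm (p - s) <= rho -> False.
Proof.
move=> clK nKx.
have /nbhs_ballP[e /= e0 eK] : nbhs x (~` K).
  exact: (open_nbhs_nbhs (conj (closed_openC clK) nKx)).
exists (e / 2); first by rewrite divr_gt0.
move=> p s rho Ks px rhoe ps; apply: (eK s) Ks.
rewrite -ball_normE /ball_/= (le_lt_trans (le_norm_enorm _))//.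
rewrite (le_lt_trans (enorm_trans p _ _))// (enormB x).
by lra.
Qed.

(** No constant relates the distance to the intersection to the distances to
    the [H i]. But a point outside the intersection has a neighbourhood at
    positive distance from some [H i], and on a ball this is uniform. *)
Lemma near_bigcap (I : Type) (H : I -> set 'rV[R]_r) z b e :
  (forall i, closed (H i)) -> 0 < e ->
  exists2 rho, 0 < rho & forall p, enorm (p - z) <= b ->
    (forall i, exists2 s, H i s & enorm (p - s) <= rho) ->
    exists2 s, (\bigcap_i H i) s & enorm (p - s) <= e.
Proof.
move=> clH e0; apply: eball_uniform => x _.
have [Hx|] := pselect ((\bigcap_i H i) x).
  by exists e => // p rho px _ _; exists x => //; exact: ltW.
rewrite /bigcap/= -existsNE => -[i /not_implyP[_ nHx]].
have [e' e'0 h] := eball_off_closed (clH i) nHx.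
exists e' => // p rho px /andP[_ rhoe] /(_ i)[s Hs ps].
by case: (h p s rho).
Qed.

(** An infeasible point has a neighbourhood at positive distance from [K], and a
    feasible point above the minimum has one on which [F] stays above it: for
    small [rho] only neighbourhoods of minimizers are left. *)
Lemma near_minimizers (K : set 'rV[R]_r) (F : 'rV[R]_r -> R) s0 z b e :
  closed K -> continuous F -> minimizers F K s0 -> 0 < e ->
  exists2 rho, 0 < rho & forall p, enorm (p - z) <= b ->
    (exists2 s, K s & enorm (p - s) <= rho) -> F p <= F s0 + rho ->
    exists2 s, minimizers F K s & enorm (p - s) <= e.
Proof.
move=> clK cF [Ks0 s0min] e0; apply: eball_uniform => x _.
have [Kx|nKx] := pselect (K x); last first.
  have [e' e'0 h] := eball_off_closed clK nKx.
  exists e' => // p rho px /andP[_ rhoe] [s Ks ps].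
  by case: (h p s rho).
have [Fx|Fx] := leP (F x) (F s0).
  exists e => // p rho px _ _ _; exists x; last exact: ltW.
  by split => // t Kt; exact: le_trans Fx (s0min t Kt).
pose d := (F x - F s0) / 2.
have d0 : 0 < d by rewrite divr_gt0// subr_gt0.
have /nbhs_ballP[e1 /= e10 h] : \forall p \near x, F s0 + d < F p.
  by have /cvgr_gt := cF x; apply; rewrite /d; lra.
exists (Num.min e1 d); first by rewrite lt_min e10.
move=> p rho; rewrite !lt_min => /andP[px _] /and3P[_ _ rhod] _ Fp.
have /h : ball x e1 p.
  rewrite -ball_normE /ball_/= (le_lt_trans (le_norm_enorm _))//.
  by rewrite enormB.
by move=> /=; lra.
Qed.

End Compactness.

(** * A descent principle without summable errors *)

Section Descent.
Context (R : realType).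
Implicit Types (u e a : nat -> R).

(** For any [d] the sequence cannot stay above [d / 2] forever, since
    it would lose a divergent sum. Once it is below [d / 2], late errors are too
    small to carry it past [d] in one step, and between [d / 2] and [d] it
    decreases. *)
Lemma descent_cvg0 u e a :
  (forall k, 0 <= u k) -> (forall k, 0 <= a k) -> e k @[k --> \oo] --> 0 ->
  (forall k, u k.+1 <= u k + e k) ->
  (forall N b, exists m, b <= \sum_(N <= k < N + m) a k) ->
  (forall d, 0 < d -> exists2 c, 0 < c &
     \forall k \near \oo, d <= u k -> u k.+1 <= u k - c * a k) ->
  u k @[k --> \oo] --> 0.
Proof.
move=> u0 a0 e0 ue dvg dec.
apply/cvgrPdist_le => d d0.
have d20 : 0 < d / 2 by rewrite divr_gt0.
have [c c0 [K1 _ hK1]] := dec _ d20.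
have [K2 _ hK2] : \forall k \near \oo, e k <= d / 2.
  by have /cvgr_le := e0; apply.
pose K := maxn K1 K2.
have [k1 [Kk1 uk1]] : exists k1, (K <= k1)%N /\ u k1 < d / 2.
  apply: contrapT => /forallNP h.
  have big k : (K <= k)%N -> d / 2 <= u k.
    by move=> Kk; rewrite leNgt; apply/negP => ukd; exact: (h k).
  have sum m : u (K + m)%N <= u K - c * \sum_(K <= k < K + m) a k.
    elim: m => [|m IH]; first by rewrite addn0 big_geq// mulr0 subr0.
    rewrite addnS big_nat_recr ?leq_addr//= mulrDr opprD addrA.
    have /= := hK1 (K + m)%N.
    rewrite (leq_trans (leq_maxl K1 K2) (leq_addr _ _)) => /(_ isT).
    by rewrite big ?leq_addr// => /(_ isT); lra.
  have [m] := dvg K ((u K + 1) / c).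
  rewrite ler_pdivrMr// mulrC => h1.
  by have := u0 (K + m)%N; have := sum m; lra.
near=> k.
have kk1 : (k1 <= k)%N by near: k; exact: nbhs_infty_ge.
rewrite sub0r normrN ger0_norm//.
rewrite -(subnKC kk1); elim: (k - k1)%N => [|m IH]; first by rewrite addn0; lra.
rewrite addnS.
have Km : (K <= k1 + m)%N by rewrite (leq_trans Kk1)// leq_addr.
have [h|h] := leP (d / 2) (u (k1 + m)%N).
  have /= := hK1 (k1 + m)%N (leq_trans (leq_maxl _ _) Km) h.
  by have := mulr_ge0 (ltW c0) (a0 (k1 + m)%N); lra.
have /= := hK2 (k1 + m)%N (leq_trans (leq_maxr _ _) Km).
by have := ue (k1 + m)%N; lra.
Unshelve. all: by end_near. Qed.
End Descent.

(** * One step of the algorithm *)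

Section Averaging.
Context (R : realType) (n r : nat).
Implicit Types (a : 'I_n -> R) (x : 'I_n -> 'rV[R]_r) (z : 'rV[R]_r).

(** Bias-variance decomposition: the cross terms cancel because [v] is the
    weighted mean. *)
Lemma weighted_variance a x z : \sum_j a j = 1 ->
  let v := \sum_j a j *: x j in
  \sum_j a j * enorm (x j - z) ^+ 2 =
  enorm (v - z) ^+ 2 + \sum_j a j * enorm (x j - v) ^+ 2.
Proof.
move=> a1 v; rewrite sqr_enorm.
have e j : a j * enorm (x j - z) ^+ 2 = a j * dot (v - z) (v - z) +
    a j * enorm (x j - v) ^+ 2 + 2 * dot (a j *: (x j - v)) (v - z).
  rewrite !sqr_enorm -[x j - z](subrKA v).
  rewrite [dot (x j - v + _) _]dotDl !(dotDr (x j - v)) dotZl.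
  by rewrite (dotC (v - z) (x j - v)); ring.
rewrite (eq_bigr _ (fun j _ => e j)) !big_split/= -mulr_suml a1 mul1r.
rewrite -mulr_sumr -dot_suml (_ : \sum_j a j *: (x j - v) = 0).
  by rewrite dot0l mulr0 addr0.
under eq_bigr do rewrite scalerBr.
by rewrite sumrB -scaler_suml a1 scale1r subrr.
Qed.

Lemma average_variance x z : (0 < n)%N ->
  \sum_i enorm (x i - z) ^+ 2 =
  n%:R * enorm (average x - z) ^+ 2 + \sum_i enorm (x i - average x) ^+ 2.
Proof.
move=> n0; have n_neq0 : n%:R != 0 :> R by rewrite pnatr_eq0 -lt0n.
have a1 : \sum_(j < n) n%:R^-1 = 1 :> R.
  by rewrite sumr_const card_ord -[LHS]mulr_natr mulVf.
have := weighted_variance x z a1; rewrite /=.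
have -> : \sum_j n%:R^-1 *: x j = average x by rewrite /average scaler_sumr.
rewrite -!mulr_sumr => /(congr1 (fun t => n%:R * t)).
by rewrite mulrDr [in LHS]mulrA [X in _ = _ + X -> _]mulrA mulfV// !mul1r.
Qed.

Lemma average_le x z (b : R) : (0 < n)%N ->
  (forall i, enorm (x i - z) <= b) -> enorm (average x - z) <= b.
Proof.
move=> n0 xb; have b0 : 0 <= b by exact: le_trans (enorm_ge0 _) (xb (Ordinal n0)).
rewrite enorm_le// -(ler_pM2l (_ : 0 < n%:R)) ?ltr0n// -sqr_enorm.
have := average_variance x z n0.
have : \sum_i enorm (x i - z) ^+ 2 <= \sum_(i < n) b ^+ 2.
  by apply: ler_sum => i _; rewrite ler_sqr ?nnegrE ?enorm_ge0.
rewrite sumr_const card_ord -[b ^+ 2 *+ n]mulr_natl.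
have : 0 <= \sum_i enorm (x i - average x) ^+ 2.
  by apply: sumr_ge0 => i _; exact: sqr_ge0.
lra.
Qed.

End Averaging.

Section Step.
Context (R : realType) (n r : nat).
Variables (f : 'I_n -> 'rV[R]_r -> R) (H : 'I_n -> set 'rV[R]_r).
Variables (T : R) (gamma : 'I_n -> R) (A : 'M[R]_n).
Variables (x : 'I_n -> 'rV[R]_r) (q : 'I_n -> R).
Hypothesis f_diff : forall i p, differentiable (f i) p.
Hypothesis f_convex : forall i, convex_function [set: 'rV[R]_r] (f i).
Hypothesis H_closed : forall i, closed (H i).
Hypothesis H_convex : forall i, convex_set (H i).
Hypothesis A_ge0 : forall i j, 0 <= A i j.
Hypothesis A_row : forall i, \sum_j A i j = 1.
Hypothesis A_col : forall j, \sum_i A i j = 1.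
Hypothesis T_gt0 : 0 < T.
Hypothesis gamma_bounds : forall i, 0 < gamma i < 1.
Hypothesis q_gt0 : forall i, 0 < q i.
Implicit Types (i j : 'I_n) (z : 'rV[R]_r).

Local Notation v := (mix A x).
Local Notation w := (grad_step f T A x q).
Local Notation P i := (nearest_point (H i) (w i)).
Local Notation g i := (grad (f i) (v i)).
Local Notation u := (next_x f H T gamma A x q).

(** Reading the switch as a step that may be zero lets one inequality cover both
    branches of the algorithm. *)
Definition stepsize i : R :=
  if Num.sqrt (q i) <= enorm (g i) ^+ 2 then 0 else (Num.sqrt (q i))^-1.

Lemma mixE i : mix A x i = \sum_j A i j *: x j.
Proof.
rewrite /mix [RHS](bigID (mem (i |: neighbors A i)))/= [X in _ + X]big1 ?addr0//.
move=> j; rewrite !inE /digraph negb_or negb_and negbK => /andP[ji].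
rewrite eq_sym (negbTE ji)/= -leNgt => Aij.
by rewrite (_ : A i j = 0) ?scale0r//; apply/eqP; rewrite eq_le Aij A_ge0.
Qed.

Lemma grad_stepE i : w i = v i - (T * stepsize i) *: g i.
Proof.
by rewrite /grad_step/switched_grad /stepsize; case: ifP => _;
  rewrite ?mulr0 ?scale0r ?scaler0// scalerA.
Qed.

Lemma sqrt_q_gt0 i : 0 < Num.sqrt (q i).
Proof. by rewrite sqrtr_gt0. Qed.

Lemma stepsize_ge0 i : 0 <= stepsize i.
Proof. by rewrite /stepsize; case: ifP => // _; rewrite invr_ge0 sqrtr_ge0. Qed.

Lemma stepsize_le i : stepsize i <= (Num.sqrt (q i))^-1.
Proof. by rewrite /stepsize; case: ifP => // _; rewrite invr_ge0 sqrtr_ge0. Qed.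

(** The switch keeps the gradient only below the fourth root of [q i], so the
    quadratic error of a gradient step is of the order of the step, with no
    bound on the gradient. *)
Lemma stepsize_grad_le i : stepsize i ^+ 2 * enorm (g i) ^+ 2 <= stepsize i.
Proof.
rewrite /stepsize; case: ifPn; first by rewrite expr0n mul0r.
rewrite -ltNge => /ltW gq; rewrite expr2 -mulrA ler_piMr ?invr_ge0 ?sqrtr_ge0//.
by rewrite ler_pdivrMl ?mulr1// sqrt_q_gt0.
Qed.

Lemma grad_step_le i z : enorm (w i - z) ^+ 2 <=
  enorm (v i - z) ^+ 2 - 2 * T * stepsize i * (f i (v i) - f i z) +
  T ^+ 2 * (stepsize i ^+ 2 * enorm (g i) ^+ 2).
Proof.
rewrite grad_stepE !sqr_enorm addrAC dot_subZ.
have := convex_gradient_le z (f_diff i (v i)) (f_convex i).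
rewrite -opprB dotNr (dotC (g i)).
set d := dot _ (g i) => h.
have : 0 <= (T * stepsize i) * (d - (f i (v i) - f i z)).
  by rewrite !mulr_ge0 ?stepsize_ge0 ?(ltW T_gt0)//; lra.
by rewrite exprMn; lra.
Qed.

Lemma relaxed_next_le i z : H i z -> enorm (u i - z) ^+ 2 <=
  enorm (w i - z) ^+ 2 - gamma i * enorm (w i - P i) ^+ 2.
Proof.
move=> Hz; have /andP[/ltW g0 /ltW g1] := gamma_bounds i.
exact: relaxed_projection_le.
Qed.

Lemma mix_variance i z : enorm (v i - z) ^+ 2 =
  \sum_j A i j * enorm (x j - z) ^+ 2 - \sum_j A i j * enorm (x j - v i) ^+ 2.
Proof.
have := weighted_variance x z (A_row i); rewrite /= -mixE => ->.
by rewrite addrK.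
Qed.

Lemma mix_sqr_le i z (b : R) : (forall j, enorm (x j - z) ^+ 2 <= b) ->
  enorm (v i - z) ^+ 2 <= b.
Proof.
move=> xb; rewrite mix_variance.
apply: (@le_trans _ _ (\sum_j A i j * b)); last by rewrite -mulr_suml A_row mul1r.
rewrite lerBlDr ler_wpDr ?ler_sum ?sumr_ge0// => j _.
  by rewrite mulr_ge0 ?sqr_ge0.
by rewrite ler_wpM2l.
Qed.

(** Row sums turn mixing into an average minus a variance, and column sums make
    the averages add up to the previous total. *)
Lemma total_next_le z : (forall i, H i z) ->
  \sum_i enorm (u i - z) ^+ 2 <= \sum_i enorm (x i - z) ^+ 2
   - \sum_i (\sum_j A i j * enorm (x j - v i) ^+ 2
             + gamma i * enorm (w i - P i) ^+ 2)
   + \sum_i (T ^+ 2 * (stepsize i ^+ 2 * enorm (g i) ^+ 2)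
             - 2 * T * stepsize i * (f i (v i) - f i z)).
Proof.
move=> Hz.
have -> : \sum_i enorm (x i - z) ^+ 2 =
    \sum_i \sum_j A i j * enorm (x j - z) ^+ 2.
  rewrite exchange_big/=; apply: eq_bigr => j _.
  by rewrite -mulr_suml A_col mul1r.
rewrite -sumrB -big_split; apply: ler_sum => i _ /=.
have := relaxed_next_le (Hz i); have := grad_step_le i z.
by have := mix_variance i z; lra.
Qed.

End Step.

(** * Growth of the adaptive gains *)

Section Gains.
Context (R : realType).
Implicit Types (q s : nat -> R) (b c : R).

Lemma atan_expR_lipschitz (a b : R) :
  `|atan (expR a) - atan (expR b)| <= `|a - b|.
Proof.
wlog ba : a b / b <= a.
  by move=> h; have [/h//|/ltW/h] := leP b a; rewrite distrC (distrC b).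
have d (t : R) : t \in `]b, a[ ->
    is_derive t 1 (fun t : R => atan (expR t)) ((1 + expR t ^+ 2)^-1 * expR t).
  by move=> _; exact: (@is_derive1_comp _ (@atan R) expR t).
have c : {within `[b, a], continuous (fun t : R => atan (expR t))}.
  apply: continuous_subspaceT => t.
  apply: (@continuous_comp _ _ _ expR (@atan R)).
    exact: continuous_expR.
  exact: continuous_atan.
have [t _ ->] := MVT_segment ba d c.
rewrite normrM ler_piMl// ger0_norm ?mulr_ge0 ?invr_ge0 ?expR_ge0 ?addr_ge0//.
rewrite mulrC ler_pdivrMr ?mul1r; have := sqr_ge0 (expR t - 1); nra.
Qed.

Lemma atan_expR_bounds (a : R) : 0 <= a -> pi / 4 <= atan (expR a) <= pi / 2.
Proof.
move=> a0; rewrite (ltW (atan_ltpi2 _)) andbT -atan1 le_atan//.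
by rewrite -expR0 ler_expR.
Qed.

Lemma gain_sum q s : (forall k, q k.+1 = q k + s k) ->
  forall k, q k = q 0%N + \sum_(0 <= l < k) s l.
Proof.
move=> qs; elim=> [|k IH]; first by rewrite big_geq// addr0.
by rewrite qs IH big_nat_recr//= addrA.
Qed.

Lemma gain_ge q s c : (forall k, q k.+1 = q k + s k) -> (forall k, c <= s k) ->
  forall k, q 0%N + k%:R * c <= q k.
Proof.
move=> qs cs; elim=> [|k IH]; first by rewrite mul0r addr0.
by rewrite qs -natr1 mulrDl mul1r addrA lerD.
Qed.

Lemma gain_le q s c : (forall k, q k.+1 = q k + s k) -> (forall k, s k <= c) ->
  forall k, q k <= q 0%N + k%:R * c.
Proof.
move=> qs cs; elim=> [|k IH]; first by rewrite mul0r addr0.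
by rewrite qs -natr1 mulrDl mul1r addrA lerD.
Qed.

(** The difference [q - q'] is a sum of terms that tend to 0, hence [o(k)] by
    Cesaro's lemma, whereas [q'] grows at least like [c k]. *)
Lemma gain_ratio_cvg1 q s q' s' c : 0 < c -> 0 <= q' 0%N ->
  (forall k, q k.+1 = q k + s k) -> (forall k, q' k.+1 = q' k + s' k) ->
  (forall k, c <= s' k) -> s k - s' k @[k --> \oo] --> 0 ->
  q k / q' k @[k --> \oo] --> (1 : R).
Proof.
move=> c0 q'0 qs qs' cs' ss'.
rewrite -(cvg_shiftS (fun k => q k / q' k)).
have q'ge k : k.+1%:R * c <= q' k.+1.
  by have := gain_ge qs' cs' k.+1; lra.
have q'gt0 k : 0 < q' k.+1.
  by apply: lt_le_trans (q'ge k); rewrite mulr_gt0// ltr0n.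
pose m := arithmetic_mean (fun k => s k - s' k).
pose b k : R := c^-1 * (`|q 0%N - q' 0%N| * k.+1%:R^-1 + `|m k|).
have b0 : b k @[k --> \oo] --> 0.
  rewrite -(mulr0 c^-1); apply: cvgMr.
  rewrite -(addr0 0); apply: cvgD.
    by rewrite -(mulr0 `|q 0%N - q' 0%N|); apply: cvgMr; exact: cvg_harmonic.
  by rewrite -(@normr0 _ R); apply: cvg_norm; exact: cesaro.
have dist k : `|q k.+1 / q' k.+1 - 1| <= b k.
  have -> : q k.+1 / q' k.+1 - 1 = (q k.+1 - q' k.+1) / q' k.+1.
    by rewrite mulrBl divff// gt_eqF.
  rewrite normrM normfV (gtr0_norm (q'gt0 k)) ler_pdivrMr//.
  have -> : q k.+1 - q' k.+1 = (q 0%N - q' 0%N) + k.+1%:R * m k.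
    rewrite (gain_sum qs) (gain_sum qs') /m/arithmetic_mean/= mulrA divff//.
    rewrite mul1r seriesEnat/= sumrB; ring.
  apply: le_trans (ler_normD _ _) _.
  rewrite normrM (ger0_norm (ler0n _ _)).
  have -> : `|q 0%N - q' 0%N| + k.+1%:R * `|m k| = b k * (k.+1%:R * c).
    by rewrite /b; field; rewrite !gt_eqF//= ?ltr0n.
  apply: ler_wpM2l (q'ge k); apply: mulr_ge0; first by rewrite invr_ge0 ltW.
  by apply: addr_ge0 => //; apply: mulr_ge0; rewrite ?invr_ge0.
apply/cvgrPdist_le => e e0; near=> k.
rewrite distrC (le_trans (dist k))//; near: k.
by have /cvgr_le := b0; apply.
Unshelve. all: by end_near. Qed.

Lemma invsqrt_gain_cvg0 q s c : 0 < c -> 0 <= q 0%N ->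
  (forall k, q k.+1 = q k + s k) -> (forall k, c <= s k) ->
  (Num.sqrt (q k))^-1 @[k --> \oo] --> 0.
Proof.
move=> c0 q0 qs cs; apply/cvgrPdist_le => e e0; near=> k.
have qk : e ^- 2 <= q k.
  apply: le_trans (_ : k%:R * c <= _); last by have := gain_ge qs cs k; lra.
  rewrite -ler_pdivrMr//; near: k; exact: nbhs_infty_ger.
have e20 : 0 < e ^- 2 by rewrite invr_gt0 exprn_gt0.
have qk0 : 0 < q k by exact: lt_le_trans qk.
rewrite sub0r normrN normfV ger0_norm ?sqrtr_ge0//.
rewrite -[e]invrK lef_pV2 ?posrE ?sqrtr_gt0 ?invr_gt0//.
by rewrite -(ger0_norm (ltW e0)) -normfV -sqrtr_sqr ler_wsqrtr// exprVn.
Unshelve. all: by end_near. Qed.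

(** The terms decrease, so the block from [N] to [N + m] is at least [m] times
    its last term, which is of order [1 / sqrt m]. *)
Lemma invsqrt_gain_dvg q s c : 0 < q 0%N ->
  (forall k, q k.+1 = q k + s k) -> (forall k, 0 <= s k <= c) ->
  forall N b, exists m, b <= \sum_(N <= k < N + m) (Num.sqrt (q k))^-1.
Proof.
move=> q0 qs cs N b.
have c0 : 0 <= c by have /andP[] := cs 0%N; exact: le_trans.
have qge k l : (k <= l)%N -> q k <= q l.
  move=> /subnKC <-; elim: (l - k)%N => [|m IH]; first by rewrite addn0.
  by rewrite addnS qs (le_trans IH)// lerDl; have /andP[] := cs (k + m)%N.
have q_gt0 k : 0 < q k by exact: lt_le_trans (qge 0%N k (leq0n k)).
pose D := q 0%N + N.+1%:R * c.
have D0 : 0 <= D by rewrite addr_ge0 ?mulr_ge0 ?(ltW q0).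
(* [q (N + m) <= D m], so the block is at least [sqrt (m / D)]. *)
exists (Num.truncn (b ^+ 2 * D)).+1; set m := _.+1.
have mb : b ^+ 2 * D <= m%:R.
  by rewrite ltW// truncnS_gt.
have m1 : 1 <= m%:R :> R by rewrite ler1n.
have qm : q (N + m)%N <= D * m%:R.
  have sc k : s k <= c by have /andP[] := cs k.
  apply: le_trans (gain_le qs sc (N + m)%N) _.
  rewrite /D mulrDl lerD// ?ler_peMr ?(ltW q0)// mulrAC ler_wpM2r//.
  by rewrite -natrM ler_nat mulSn addnC leq_add2l leq_pmulr.
have sq0 : 0 < Num.sqrt (q (N + m)%N) by rewrite sqrtr_gt0.
apply: (@le_trans _ _ (m%:R / Num.sqrt (q (N + m)%N))).
  rewrite ler_pdivlMr// (le_trans (ler_norm _))// normrM.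
  rewrite -ler_sqr ?nnegrE// exprMn !real_normK ?num_real//.
  rewrite sqr_sqrtr ?(ltW (q_gt0 _))//.
  rewrite (le_trans (ler_wpM2l (sqr_ge0 _) qm))// mulrA expr2 ler_wpM2r//.
have -> : m%:R / Num.sqrt (q (N + m)%N) =
    \sum_(N <= k < N + m) (Num.sqrt (q (N + m)%N))^-1.
  by rewrite sumr_const_nat addKn mulr_natl.
apply: ler_sum_nat => k /andP[_ kN].
by rewrite lef_pV2 ?posrE ?sqrtr_gt0// ler_wsqrtr// qge// ltnW.
Qed.

End Gains.

(** * Gradient bounds and existence of optima *)

Section Objective.
Context (R : realType) (r : nat).
Implicit Types (f : 'rV[R]_r -> R) (z p : 'rV[R]_r) (b : R).

(** A unit step from [p] along the gradient raises [f] by at least the norm of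
    the gradient, and [f] is bounded on the ball of radius [b + 1]. *)
Lemma grad_bounded f z b : (forall p, differentiable f p) ->
  convex_function [set: 'rV[R]_r] f ->
  exists2 L, 0 < L & forall p, enorm (p - z) <= b -> enorm (grad f p) <= L.
Proof.
move=> df cf.
have [b0|b0] := ltP b 0.
  by exists 1 => // p /(le_trans (enorm_ge0 _)); rewrite leNgt b0.
have S0 : [set p | enorm (p - z) <= b + 1] !=set0.
  by exists z; rewrite /= subrr enormE dot0l sqrtr0 addr_ge0.
have cS := @compact_eball R r z (b + 1).
have fc : {within [set p | enorm (p - z) <= b + 1], continuous f}.
  by apply: continuous_subspaceT => p; exact: differentiable_continuous.
have [pmax _ fmax] := EVT_max_rV S0 cS fc.
have [pmin _ fmin] := EVT_min_rV S0 cS fc.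
exists (`|f pmax - f pmin| + 1) => [|p pz]; first by rewrite ltr_wpDl.
set g := grad f p.
have [->|g0] := eqVneq (enorm g) 0; first by rewrite addr_ge0.
have g_gt0 : 0 < enorm g by rewrite lt_def g0 enorm_ge0.
pose h := p + (enorm g)^-1 *: g.
have hp : enorm (h - p) = 1.
  by rewrite /h [p + _]addrC addrK enormZ gtr0_norm ?invr_gt0// mulVf.
have hz : enorm (h - z) <= b + 1.
  by rewrite (le_trans (enorm_trans p _ _))// hp addrC lerD2r.
have pz1 : enorm (p - z) <= b + 1 by rewrite (le_trans pz)// lerDl.
have := convex_gradient_le h (df p) cf.
rewrite /h [p + _]addrC addrK -/g dotZr -sqr_enorm expr2 mulrA mulVf// mul1r.
rewrite -[_ *: g + p]addrC -/h => fh.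
have := fmax h; rewrite inE => /(_ hz) hmax.
have := fmin p; rewrite inE => /(_ pz1) hmin.
have := ler_norm (f pmax - f pmin); lra.
Qed.

Lemma convex_drop_le f z v L : differentiable f z ->
  convex_function [set: 'rV[R]_r] f ->
  enorm (grad f z) <= L -> f z - f v <= L * enorm (v - z).
Proof.
move=> df cf gL; have := convex_gradient_le v df cf.
have := cauchy_schwarz (grad f z) (v - z); rewrite ler_norml => /andP[h _].
have := ler_wpM2r (enorm_ge0 (v - z)) gL; lra.
Qed.

Lemma minimizers_closed (F : 'rV[R]_r -> R) K : closed K -> continuous F ->
  closed (minimizers F K).
Proof.
move=> clK cF.
have -> : minimizers F K = K `&` \bigcap_(t in K) [set s | F s <= F t].
  by apply/seteqP; split=> s [].
apply: closedI => //; apply: closed_bigI => t _.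
have c : {in ~` F @^-1` [set y | y <= F t], continuous F} by move=> p _.
exact: (preimage_closed c (@closed_le _ (F t))).
Qed.

(** One coercive summand is enough, the others being bounded below: outside a
    ball around a feasible [s0] the sum exceeds its value at [s0]. *)
Lemma minimizer_exists (n : nat) (f : 'I_n -> 'rV[R]_r -> R)
    (K : set 'rV[R]_r) : (0 < n)%N ->
  (forall i p, differentiable (f i) p) ->
  (forall i, convex_function [set: 'rV[R]_r] (f i)) ->
  (forall i, [set p | grad (f i) p = 0] !=set0) ->
  (forall i, bounded_set [set p | grad (f i) p = 0]) ->
  closed K -> K !=set0 ->
  minimizers (fun s => \sum_i f i s) K !=set0.
Proof.
move=> n0 df cf crit0 critb clK [s0 Ks0].
pose F s := \sum_i f i s.
have cF : continuous F.
  move=> p; apply: (cvg_sum (F := nbhs p)) => i.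
  exact: differentiable_continuous.
have /choice[m fm] : forall i, exists m, forall p, m <= f i p.
  move=> i.
  have [p0 /= p00] := crit0 i; exists (f i p0) => p.
  by have := convex_gradient_le p (df i p0) (cf i); rewrite p00 dot0l addr0.
pose i0 := Ordinal n0.
have [b b0 fb] := @convex_coercive R r (f i0) s0
  (F s0 - \sum_(i | i != i0) m i) (df i0) (cf i0) (crit0 i0) (critb i0).
pose C := [set p | enorm (p - s0) <= b] `&` K.
have cC : compact C := compact_closedI (@compact_eball _ _ s0 b) clK.
have C0 : C !=set0.
  by exists s0; split => //=; rewrite subrr enormE dot0l sqrtr0 ltW.
have [|p] := EVT_min_rV C0 cC (f := F); first exact: continuous_subspaceT.
rewrite inE => -[pb Kp] pmin; exists p; split => // t Kt.
have [tb|/ltW tb] := leP (enorm (t - s0)) b; first by apply: pmin; rewrite inE.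
apply: (@le_trans _ _ (F s0)).
  by apply: pmin; rewrite inE; split => //=; rewrite subrr enormE dot0l sqrtr0 ltW.
rewrite [leRHS](bigD1 i0)//= -lerBlDr (le_trans _ (fb _ tb))//.
by rewrite lerB// ler_sum.
Qed.

End Objective.

(** * Boundedness of the trajectory *)

Section Trajectory.
Context (R : realType) (n r : nat).
Variables (f : 'I_n -> 'rV[R]_r -> R) (H : 'I_n -> set 'rV[R]_r).
Variables (A : nat -> 'M[R]_n) (T : R) (gamma : 'I_n -> R).
Variables (x : nat -> 'I_n -> 'rV[R]_r) (q : nat -> 'I_n -> R).
Hypothesis f_diff : forall i p, differentiable (f i) p.
Hypothesis f_convex : forall i, convex_function [set: 'rV[R]_r] (f i).
Hypothesis H_closed : forall i, closed (H i).
Hypothesis H_convex : forall i, convex_set (H i).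
Hypothesis A_ge0 : forall k i j, 0 <= A k i j.
Hypothesis A_row : forall k i, \sum_j A k i j = 1.
Hypothesis A_col : forall k j, \sum_i A k i j = 1.
Hypothesis T_gt0 : 0 < T.
Hypothesis gamma_bounds : forall i, 0 < gamma i < 1.
Hypothesis crit_neq0 : forall i, [set p | grad (f i) p = 0] !=set0.
Hypothesis crit_bounded : forall i, bounded_set [set p | grad (f i) p = 0].
Hypothesis q0_gt0 : forall i, 0 < q 0%N i.
Hypothesis x_next : forall k i,
  x k.+1 i = next_x f H T gamma (A k) (x k) (q k) i.
Hypothesis q_next : forall k i, q k.+1 i = next_q T (x k) (q k) i.
Implicit Types (i : 'I_n) (z : 'rV[R]_r).

Local Notation v k := (mix (A k) (x k)).
Local Notation w k := (grad_step f T (A k) (x k) (q k)).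
Local Notation P k i := (nearest_point (H i) (w k i)).
Local Notation g k i := (grad (f i) (v k i)).
Local Notation alpha k := (stepsize f (A k) (x k) (q k)).

Definition gain k i : R := atan (expR (enorm (x k i))) * T.

Lemma gain_bounds k i : pi / 4 * T <= gain k i <= pi / 2 * T.
Proof. by rewrite !ler_pM2r// atan_expR_bounds ?enorm_ge0. Qed.

Lemma gain_lb_gt0 : 0 < pi / 4 * T :> R.
Proof. by rewrite mulr_gt0// divr_gt0 ?pi_gt0. Qed.

Lemma q_ge k i : q 0%N i <= q k i.
Proof.
have gk l : 0 <= gain l i.
  by have /andP[+ _] := gain_bounds l i; apply: le_trans (ltW gain_lb_gt0).
have := gain_ge (fun k => q_next k i) gk k.
by rewrite mulr0 addr0.
Qed.

Lemma q_gt0 k i : 0 < q k i.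
Proof. exact: lt_le_trans (q_ge k i). Qed.

Lemma alpha_ge0 k i : 0 <= alpha k i.
Proof. exact: stepsize_ge0. Qed.

Lemma alpha_cvg0 i : alpha k i @[k --> \oo] --> 0.
Proof.
apply: (@squeeze_cvgr _ _ _ _ (fun=> 0) (fun k => (Num.sqrt (q k i))^-1)).
- by near=> k; rewrite alpha_ge0 stepsize_le.
- exact: cvg_cst.
- have gk k : pi / 4 * T <= gain k i by have /andP[] := gain_bounds k i.
  exact: (invsqrt_gain_cvg0 gain_lb_gt0 (ltW (q0_gt0 i)) (q_next^~ i) gk).
Unshelve. all: by end_near. Qed.

(** By induction on the largest distance: where [f i] exceeds [f i z0 + T / 2] a
    gradient step does not increase the distance, because [alpha] bounds the quadratic
    term; elsewhere [mix] is within [b i] and the step adds a bounded amount. *)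
Lemma trajectory_bounded z0 : (forall i, H i z0) ->
  exists2 b, 0 <= b & forall k i, enorm (x k i - z0) <= b.
Proof.
move=> Hz0.
have /choice[c fc] i : exists c, 0 <= c /\ forall p, f i z0 - f i p <= c.
  have [p0 /= p00] := crit_neq0 i.
  have fp0 p : f i p0 <= f i p.
    have := convex_gradient_le p (f_diff i p0) (f_convex i).
    by rewrite p00 dot0l addr0.
  by exists (f i z0 - f i p0); rewrite subr_ge0; split => // p; rewrite lerB.
have /choice[b fb] i : exists b, 0 < b /\ forall p, b <= enorm (p - z0) ->
    f i z0 + T / 2 <= f i p.
  have [b b0 hb] := @convex_coercive R r (f i) z0 (f i z0 + T / 2)
    (f_diff i) (f_convex i) (crit_neq0 i) (crit_bounded i).
  by exists b.
pose s i := (Num.sqrt (q 0%N i))^-1.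
have s0 i : 0 <= s i by rewrite invr_ge0 sqrtr_ge0.
pose t i := enorm (x 0%N i - z0) ^+ 2 + (b i ^+ 2 + s i * (T ^+ 2 + 2 * T * c i)).
have st0 i : 0 <= s i * (T ^+ 2 + 2 * T * c i).
  by rewrite mulr_ge0// addr_ge0 ?sqr_ge0// !mulr_ge0 ?(ltW T_gt0)//; case: (fc i).
have t0 i : 0 <= t i by rewrite !addr_ge0 ?sqr_ge0.
pose B := \sum_i t i.
have tB i : t i <= B.
  by rewrite /B (bigD1 i)//= lerDl sumr_ge0.
have main k : forall i, enorm (x k i - z0) ^+ 2 <= B.
  elim: k => [|k IH] i.
    apply: le_trans (tB i); rewrite lerDl addr_ge0 ?sqr_ge0//.
  rewrite x_next.
  have h1 := relaxed_next_le f T (A k) (x k) (q k) H_closed H_convex gamma_bounds (Hz0 i).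
  have h2 := grad_step_le (A k) (x k) (q k) f_diff f_convex T_gt0 i z0.
  have h3 : enorm (v k i - z0) ^+ 2 <= B.
    exact: mix_sqr_le.
  have h4 := stepsize_grad_le f (A k) (x k) (q_gt0 k) i.
  have h5 : 0 <= gamma i * enorm (w k i - P k i) ^+ 2.
    by rewrite mulr_ge0 ?sqr_ge0// ltW//; have /andP[] := gamma_bounds i.
  have h6 : T ^+ 2 * (alpha k i ^+ 2 * enorm (g k i) ^+ 2) <= T ^+ 2 * alpha k i.
    by rewrite ler_wpM2l ?sqr_ge0.
  have [b0 hb] := fb i; have [c0 hc] := fc i.
  have [bv|vb] := leP (b i) (enorm (v k i - z0)).
    have h7 := hb _ bv.
    have h8 : 0 <= 2 * T * alpha k i * (f i (v k i) - f i z0 - T / 2).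
      by rewrite mulr_ge0 ?mulr_ge0 ?stepsize_ge0 ?(ltW T_gt0)//; lra.
    by rewrite expr2 in h6; lra.
  have h7 : enorm (v k i - z0) ^+ 2 <= b i ^+ 2.
    by rewrite ler_sqr ?nnegrE ?enorm_ge0 ?(ltW b0)// ltW.
  have h8 : 0 <= 2 * T * alpha k i * (c i - (f i z0 - f i (v k i))).
    by rewrite mulr_ge0 ?mulr_ge0 ?stepsize_ge0 ?(ltW T_gt0)// subr_ge0.
  have h9 : alpha k i * (T ^+ 2 + 2 * T * c i) <= s i * (T ^+ 2 + 2 * T * c i).
    rewrite ler_wpM2r ?addr_ge0 ?sqr_ge0 ?mulr_ge0 ?(ltW T_gt0)//.
    rewrite (le_trans (stepsize_le _ _ _ _ _))// lef_pV2 ?posrE ?sqrtr_gt0 ?q_gt0//.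
    by rewrite ler_wsqrtr// q_ge.
  by have := tB i; have := sqr_ge0 (enorm (x 0%N i - z0)); rewrite /t; lra.
have B0 : 0 <= B by rewrite sumr_ge0.
exists (Num.sqrt B); first exact: sqrtr_ge0.
by move=> k i; rewrite -(ger0_norm (enorm_ge0 _)) -sqrtr_sqr ler_wsqrtr.
Qed.

(** * The Lyapunov function and its dissipation *)

Section Bounded.
Variables (z0 : 'rV[R]_r) (b : R).
Hypothesis n_gt0 : (0 < n)%N.
Hypothesis Hz0 : forall i, H i z0.
Hypothesis b_ge0 : 0 <= b.
Hypothesis x_le : forall k i, enorm (x k i - z0) <= b.

Definition spread k z : R := \sum_i enorm (x k i - z) ^+ 2.

(** What the mixing and the projections remove from the spread in one step. *)
Definition dissipation k : R :=
  \sum_i (\sum_j A k i j * enorm (x k j - v k i) ^+ 2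
          + gamma i * enorm (w k i - P k i) ^+ 2).

Definition center (K : set 'rV[R]_r) k := nearest_point K (average (x k)).

Lemma mix_le k i z (c : R) : 0 <= c -> (forall j, enorm (x k j - z) <= c) ->
  enorm (v k i - z) <= c.
Proof.
move=> c0 xc; rewrite -ler_sqr ?nnegrE ?enorm_ge0//.
by apply: mix_sqr_le => // j; rewrite ler_sqr ?nnegrE ?enorm_ge0.
Qed.

Lemma average_z0_le k : enorm (average (x k) - z0) <= b.
Proof. exact: average_le. Qed.

Lemma spread_average k z : spread k z =
  n%:R * enorm (average (x k) - z) ^+ 2
  + \sum_i enorm (x k i - average (x k)) ^+ 2.
Proof. exact: average_variance. Qed.

Lemma spread_ge0 k z : 0 <= spread k z.
Proof. by apply: sumr_ge0 => i _; exact: sqr_ge0. Qed.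

Lemma dist_le_spread k i z : enorm (x k i - z) ^+ 2 <= spread k z.
Proof.
rewrite /spread (bigD1 i)//= lerDl sumr_ge0// => j _; exact: sqr_ge0.
Qed.

Section Center.
Variable K : set 'rV[R]_r.
Hypothesis K_closed : closed K.
Hypothesis Kz0 : K z0.

Let centerP k := @nearest_pointP R r K (average (x k)) K_closed (ex_intro _ _ Kz0).

Lemma center_in k : K (center K k).
Proof. by case: (centerP k). Qed.

Lemma center_min k z : K z ->
  enorm (average (x k) - center K k) <= enorm (average (x k) - z).
Proof. by case: (centerP k) => _; apply. Qed.

(** By the decomposition of the spread at the average, its minimum over [K] is
    reached at the point of [K] nearest to the average: re-centring after a step
    never increases the Lyapunov function. *)
Lemma spread_center k z : K z -> spread k (center K k) <= spread k z.
Proof.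
move=> Kz; rewrite !spread_average lerD2r ler_wpM2l//.
by rewrite ler_sqr ?nnegrE ?enorm_ge0// center_min.
Qed.

(** The centres stay in one ball, on which gradients have a common bound. *)
Lemma center_le k : enorm (center K k - z0) <= 2 * b.
Proof.
have := center_min k Kz0; have := average_z0_le k.
have := enorm_trans (average (x k)) (center K k) z0.
by rewrite (enormB (center K k) (average _)); lra.
Qed.

End Center.

Lemma dissipation_ge0 k : 0 <= dissipation k.
Proof.
apply: sumr_ge0 => i _; have /andP[/ltW g0 _] := gamma_bounds i.
rewrite addr_ge0 ?(mulr_ge0 g0) ?sqr_ge0 ?sumr_ge0// => j _.
by rewrite mulr_ge0 ?sqr_ge0.
Qed.

Lemma spread_next k z : (forall i, H i z) ->
  spread k.+1 z <= spread k z - dissipation k +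
    \sum_i (T ^+ 2 * (alpha k i ^+ 2 * enorm (g k i) ^+ 2)
             - 2 * T * alpha k i * (f i (v k i) - f i z)).
Proof.
move=> Hz; have := total_next_le (x k) (q k) f_diff f_convex H_closed H_convex
  (A_ge0 k) (A_row k) (A_col k) T_gt0 gamma_bounds Hz.
by under eq_bigr do rewrite -x_next.
Qed.

Lemma grad_bound : exists L : 'I_n -> R, forall i, 0 < L i /\
  forall p, enorm (p - z0) <= 2 * b -> enorm (grad (f i) p) <= L i.
Proof.
suff /choice[L hL] : forall i, exists L, 0 < L /\ forall p,
    enorm (p - z0) <= 2 * b -> enorm (grad (f i) p) <= L by exists L.
move=> i.
have [L L0 hL] := @grad_bounded R r (f i) z0 (2 * b) (f_diff i) (f_convex i).
by exists L.
Qed.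

Lemma descent_error : exists e : nat -> R, [/\ forall k, 0 <= e k,
  e k @[k --> \oo] --> 0 &
  forall k z, (forall i, H i z) -> enorm (z - z0) <= 2 * b ->
    spread k.+1 z <= spread k z - dissipation k + e k].
Proof.
have [L hL] := grad_bound.
pose C i := T ^+ 2 + 2 * T * (L i * (3 * b)).
have C0 i : 0 <= C i.
  have [L0 _] := hL i.
  by rewrite addr_ge0 ?sqr_ge0 ?mulr_ge0 ?(ltW T_gt0) ?(ltW L0).
exists (fun k => \sum_i C i * alpha k i); split => [k||k z Hz zb].
- by apply: sumr_ge0 => i _; rewrite mulr_ge0// stepsize_ge0.
- rewrite [X in _ --> X](_ : 0 = \sum_(i < n) (0 : R)); last by rewrite big1.
  apply: cvg_sum => i; rewrite -(mulr0 (C i)); apply: cvgMr; exact: alpha_cvg0.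
apply: le_trans (spread_next k Hz) _; rewrite lerD2l ler_sum// => i _.
have h1 := stepsize_grad_le f (A k) (x k) (q_gt0 k) i.
have [L0 /(_ z zb) gL] := hL i.
have h2 := convex_drop_le (v k i) (f_diff i z) (f_convex i) gL.
have h3 : enorm (v k i - z) <= 3 * b.
  have := enorm_trans z0 (v k i) z; rewrite (enormB z0 z).
  by have := mix_le i b_ge0 (x_le k); lra.
have h4 : f i z - f i (v k i) <= L i * (3 * b).
  by rewrite (le_trans h2)// ler_wpM2l// ltW.
have h5 : 0 <= 2 * T * alpha k i * (L i * (3 * b) - (f i z - f i (v k i))).
  by rewrite mulr_ge0 ?mulr_ge0 ?stepsize_ge0 ?(ltW T_gt0)// subr_ge0.
have : T ^+ 2 * (alpha k i ^+ 2 * enorm (g k i) ^+ 2) <= T ^+ 2 * alpha k i.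
  by rewrite ler_wpM2l ?sqr_ge0.
rewrite /C; move: (_ * enorm _ ^+ 2) => Z; lra.
Qed.

(** * Consensus and feasibility *)

Section Consensus.
Variables (eta : R) (M : nat) (ks : nat -> nat).
Hypothesis eta_gt0 : 0 < eta.
Hypothesis A_diag : forall k i, eta <= A k i i.
Hypothesis A_edge : forall k i j, 0 < A k i j -> eta <= A k i j.
Hypothesis ks_gap : forall j, (0 < ks j.+1 - ks j <= M)%N.
Hypothesis ks_connected : forall j, strongly_connected
  (union_graph (fun k => digraph (A k)) (ks j) (ks j.+1)).

Lemma grad_move_cvg0 i : (T * alpha k i) * enorm (g k i) @[k --> \oo] --> 0.
Proof.
apply: (@squeeze_cvgr _ _ _ _ (fun=> 0) (fun k => T * Num.sqrt (alpha k i))).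
- near=> k; rewrite !mulr_ge0 ?enorm_ge0 ?stepsize_ge0 ?(ltW T_gt0)//=.
  rewrite -mulrA ler_wpM2l ?(ltW T_gt0)//.
  rewrite -(@ger0_norm _ (alpha k i * _)) ?mulr_ge0 ?enorm_ge0 ?stepsize_ge0//.
  by rewrite -sqrtr_sqr ler_wsqrtr// exprMn stepsize_grad_le//; exact: q_gt0.
- exact: cvg_cst.
- rewrite -(mulr0 T) -(@sqrtr0 R); apply: cvgMr.
  apply: continuous_cvg; [exact: sqrt_continuous|exact: alpha_cvg0].
Unshelve. all: by end_near. Qed.

(** What small dissipation at time [k] says about the agents one by one. *)
Definition calm (s : R) k := forall i,
  [/\ forall j, 0 < A k i j -> enorm (x k j - v k i) <= s,
      enorm (v k i - w k i) <= s & enorm (w k i - P k i) <= s].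

(** Every nonzero weight in the dissipation is at least
    [m = min(eta, gamma_1, ..., gamma_n)], so dissipation at most [m * s ^+ 2]
    bounds every distance in it by [s]. The move along the gradient is not
    dissipated and is small only for late times. *)
Lemma dissipation_calm s : 0 < s -> exists2 c, 0 < c &
  \forall k \near \oo, dissipation k <= c -> calm s k.
Proof.
move=> s0.
pose m := \big[Num.min/eta]_i gamma i.
have m0 : 0 < m.
  by apply: lt_bigmin => // i _; have /andP[] := gamma_bounds i.
have meta : m <= eta by exact: bigmin_le_id.
have mgam i : m <= gamma i by exact: bigmin_le.
exists (m * s ^+ 2); first by rewrite mulr_gt0// exprn_gt0.
have move_le : \forall k \near \oo, forall i,
    (T * alpha k i) * enorm (g k i) <= s.
  by apply: filter_forall => i; have /cvgr_le := grad_move_cvg0 i; apply.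
near=> k.
have mv : forall i, (T * alpha k i) * enorm (g k i) <= s by near: k.
move=> dk i.
have term_le (a p : R) : m <= a -> a * p ^+ 2 <= dissipation k -> 0 <= p -> p <= s.
  move=> ma ap p0; rewrite -ler_sqr ?nnegrE ?(ltW s0)//.
  rewrite -(ler_pM2l (lt_le_trans m0 ma)) (le_trans ap)// (le_trans dk)//.
  by rewrite ler_wpM2r ?sqr_ge0.
have mix_i : 0 <= \sum_j A k i j * enorm (x k j - v k i) ^+ 2.
  by apply: sumr_ge0 => j _; rewrite mulr_ge0 ?sqr_ge0.
have gam_i : 0 <= gamma i * enorm (w k i - P k i) ^+ 2.
  by apply: mulr_ge0; [exact: le_trans (ltW m0) (mgam i)|exact: sqr_ge0].
have di : \sum_j A k i j * enorm (x k j - v k i) ^+ 2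
    + gamma i * enorm (w k i - P k i) ^+ 2 <= dissipation k.
  rewrite /dissipation [leRHS](bigD1 i)//= lerDl sumr_ge0// => l _.
  have /andP[/ltW gl _] := gamma_bounds l.
  rewrite addr_ge0 ?(mulr_ge0 gl) ?sqr_ge0 ?sumr_ge0// => j _.
  by rewrite mulr_ge0 ?sqr_ge0.
split.
- move=> j Aij; apply: (term_le (A k i j)); rewrite ?enorm_ge0//.
    exact: le_trans meta (A_edge Aij).
  apply: le_trans di; rewrite ler_wpDr// (bigD1 j)//= lerDl sumr_ge0// => l _.
  by rewrite mulr_ge0 ?sqr_ge0.
- rewrite grad_stepE opprB addrC subrK enormZ ger0_norm//.
  by rewrite mulr_ge0 ?stepsize_ge0 ?(ltW T_gt0).
- apply: (term_le (gamma i)); rewrite ?enorm_ge0//.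
  by apply: le_trans di; rewrite ler_wpDl.
Unshelve. all: by end_near. Qed.

Lemma calm_self s k i : calm s k -> enorm (x k i - v k i) <= s.
Proof. by move=> /(_ i)[+ _ _]; apply; exact: lt_le_trans (A_diag k i). Qed.

Lemma calm_step s k i : calm s k -> enorm (x k.+1 i - x k i) <= 3 * s.
Proof.
move=> ck; have [_ vw wP] := ck i; have xv := calm_self i ck.
have /andP[/ltW g0 /ltW g1] := gamma_bounds i.
have uw : enorm (x k.+1 i - w k i) <= s.
  rewrite x_next /next_x.
  have -> : (1 - gamma i) *: w k i + gamma i *: P k i - w k i =
      - (gamma i *: (w k i - P k i)).
    by apply/rowP => j; rewrite !mxE; ring.
  by rewrite enormN enormZ ger0_norm// (le_trans _ wP)// ler_piMl// enorm_ge0.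
have := enorm_trans (w k i) (x k.+1 i) (x k i).
have := enorm_trans (v k i) (w k i) (x k i).
rewrite (enormB (w k i) (v k i)) (enormB (v k i) (x k i)); lra.
Qed.

Lemma calm_drift s a m i :
  (forall k, (a <= k < a + m)%N -> calm s k) ->
  enorm (x (a + m)%N i - x a i) <= m%:R * (3 * s).
Proof.
elim: m => [|m IH] h; first by rewrite addn0 subrr enormE dot0l sqrtr0 mul0r.
have hm : enorm (x (a + m)%N i - x a i) <= m%:R * (3 * s).
  apply: IH => k /andP[ak km]; apply: h; rewrite ak/= (leq_trans km)//.
  by rewrite leq_add2l.
have /(calm_step i) st : calm s (a + m)%N.
  by apply: h; rewrite leq_addr/= addnS.
rewrite addnS -natr1 mulrDl mul1r.
by have := enorm_trans (x (a + m)%N i) (x (a + m).+1 i) (x a i); lra.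
Qed.

(** The edge is present at some time of the window, when both of its ends are
    within [s] of the mixed point; before that each end has drifted by at most
    [3 * s] per step. *)
Lemma calm_edge s j i l : 0 <= s ->
  (forall k, (ks j <= k < ks j.+1)%N -> calm s k) ->
  union_graph (fun k => digraph (A k)) (ks j) (ks j.+1) l i ->
  enorm (x (ks j) l - x (ks j) i) <= (2 + 6 * M%:R) * s.
Proof.
move=> s0 h /hasP[k]; rewrite mem_index_iota => kin /andP[_ Ail].
have [/(_ l Ail) lv _ _] := h k kin i; have iv := calm_self i (h k kin).
have /andP[ak kb] := kin.
have kM : (k - ks j)%:R * (3 * s) <= M%:R * (3 * s).
  rewrite ler_wpM2r ?mulr_ge0// ler_nat.
  have /andP[_] := ks_gap j; apply: leq_trans; rewrite leq_sub2r// ltnW//.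
have drift p : enorm (x k p - x (ks j) p) <= M%:R * (3 * s).
  apply: le_trans kM; rewrite -{1}(subnKC ak); apply: calm_drift => k'.
  rewrite subnKC// => /andP[k1 k2]; apply: h; rewrite k1/=.
  exact: ltn_trans kb.
have := drift l; have := drift i.
have := enorm_trans (x k l) (x (ks j) l) (x (ks j) i).
have := enorm_trans (v k i) (x k l) (x (ks j) i).
have := enorm_trans (x k i) (v k i) (x (ks j) i).
rewrite (enormB (v k i) (x k i)) (enormB (x (ks j) l) (x k l)); lra.
Qed.

(** A path without repeated vertices in the union graph has at most [n] edges. *)
Lemma calm_consensus s j i l : 0 <= s ->
  (forall k, (ks j <= k < ks j.+1)%N -> calm s k) ->
  enorm (x (ks j) l - x (ks j) i) <= n%:R * ((2 + 6 * M%:R) * s).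
Proof.
move=> s0 h.
set D := (2 + _) * s.
have D0 : 0 <= D by rewrite mulr_ge0// addr_ge0// mulr_ge0.
have /connectP[p ep ->] := ks_connected j l i.
case/shortenP: ep => p' ep' up' _.
have : (size p' <= n)%N.
  have := max_card (mem (l :: p')); rewrite (card_uniqP up') card_ord.
  exact: ltnW.
rewrite -(ler_nat R) => /(ler_wpM2r D0); apply: le_trans.
elim: p' l ep' {up'} => [|a p' IH] l /=.
  by rewrite subrr enormE dot0l sqrtr0 mul0r.
move=> /andP[la /IH ap]; have := calm_edge s0 h la.
rewrite -(natr1 (size p')) -/D.
by have := enorm_trans (x (ks j) a) (x (ks j) l) (x (ks j) (last a p')); lra.
Qed.

Lemma ks_lt j : (ks j < ks j.+1)%N.
Proof. by have /andP[] := ks_gap j; rewrite subn_gt0. Qed.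

Lemma ks_ge j : (j <= ks j)%N.
Proof. by elim: j => // j IH; exact: leq_ltn_trans IH (ks_lt j). Qed.

Local Notation Hcap := (\bigcap_i H i).

Lemma Hcap_closed : closed Hcap.
Proof. exact: closed_bigI. Qed.

Lemma Hcap_z0 : Hcap z0.
Proof. by move=> i _. Qed.

(** If little is dissipated over a window then the agents agree up to a
    multiple of [s], and their average is as close to a point of each [H i]: the
    projection computed by agent [i]. Hence the average is close to the
    intersection. *)
Lemma small_dissipation d : 0 < d -> exists2 c, 0 < c & \forall j \near \oo,
  \sum_(ks j <= k < ks j.+1) dissipation k <= c ->
  spread (ks j) (center Hcap (ks j)) <= d.
Proof.
move=> d0.
have nR : 0 < n%:R :> R by rewrite ltr0n.
pose e := Num.sqrt (d / (2 * n%:R)).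
have e0 : 0 < e by rewrite sqrtr_gt0 divr_gt0// mulr_gt0.
have e2 : n%:R * e ^+ 2 = d / 2.
  by rewrite sqr_sqrtr ?divr_ge0 ?mulr_ge0 ?ltW//; field; rewrite gt_eqF.
have [rho rho0 near_Hcap] := near_bigcap z0 b H_closed e0.
(* [kappa * s] adds to the disagreement of the agents the three moves from an
   agent to its mixed point, its gradient step and its projection. *)
pose kappa : R := n%:R * (2 + 6 * M%:R) + 3.
have kappa0 : 0 < kappa by rewrite ltr_wpDl// mulr_ge0// addr_ge0// mulr_ge0.
pose s := Num.min rho e / kappa.
have re0 : 0 < Num.min rho e by rewrite lt_min rho0.
have s0 : 0 < s by rewrite divr_gt0.
have ks_rho : kappa * s <= rho by rewrite mulrC divfK ?gt_eqF// ge_min lexx.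
have ks_e : kappa * s <= e by rewrite mulrC divfK ?gt_eqF// ge_min lexx orbT.
have [c c0 [N _ hN]] := dissipation_calm s0.
exists c => //; exists N => // j /= Nj hc.
have calm_j k : (ks j <= k < ks j.+1)%N -> calm s k.
  move=> /andP[jk kj]; apply: hN; first exact: leq_trans (leq_trans Nj (ks_ge j)) jk.
  apply: le_trans hc; rewrite (@big_cat_nat _ _ _ k)//=; last exact: ltnW.
  rewrite [X in _ + X]big_ltn// addrCA lerDl addr_ge0// sumr_ge0// => l _.
    exact: dissipation_ge0.
  exact: dissipation_ge0.
set a := ks j in calm_j *; set xa := average (x a).
pose D : R := n%:R * ((2 + 6 * M%:R) * s).
have kD : kappa * s = D + 3 * s by rewrite /kappa /D; ring.
have xi i : enorm (xa - x a i) <= D.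
  by apply: average_le => // l; exact: calm_consensus (ltW s0) calm_j.
have calm_a : calm s a by apply: calm_j; rewrite leqnn ks_lt.
have [|p Hp xap] := near_Hcap xa (average_z0_le a).
  move=> i; have [_ vw wP] := calm_a i; have xv := calm_self i calm_a.
  exists (P a i); first by case: (@nearest_pointP _ _ (H i) (w a i) (@H_closed i)
    (ex_intro _ _ (Hz0 i))).
  apply: le_trans ks_rho; rewrite kD; have := xi i.
  have := enorm_trans (x a i) xa (P a i).
  have := enorm_trans (v a i) (x a i) (P a i).
  have := enorm_trans (w a i) (v a i) (P a i); lra.
apply: le_trans (spread_center Hcap_closed Hcap_z0 a Hp) _.
rewrite spread_average -/xa.
have h1 : n%:R * enorm (xa - p) ^+ 2 <= d / 2.
  by rewrite -e2 ler_wpM2l// ler_sqr ?nnegrE ?enorm_ge0// ltW.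
have : \sum_i enorm (x a i - xa) ^+ 2 <= \sum_(i < n) e ^+ 2.
  apply: ler_sum => i _; rewrite ler_sqr ?nnegrE ?enorm_ge0 ?(ltW e0)//.
  rewrite enormB (le_trans (xi i))// (le_trans _ ks_e)// kD lerDl mulr_ge0//.
  exact: ltW.
rewrite sumr_const card_ord -[_ *+ n]mulr_natl e2; lra.
Qed.

(** The point [z] is kept fixed over the whole run; re-centring happens only at
    the switching times. *)
Lemma spread_run (e : nat -> R) z a m :
  (forall k, spread k.+1 z <= spread k z - dissipation k + e k) ->
  spread (a + m) z <= spread a z - \sum_(a <= k < a + m) dissipation k
    + \sum_(a <= k < a + m) e k.
Proof.
move=> h; elim: m => [|m IH]; first by rewrite addn0 !big_geq// subr0 addr0.
rewrite addnS !big_nat_recr ?leq_addr//=.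
by have := h (a + m)%N; move: IH; lra.
Qed.

(** The descent principle is applied along the switching times. Since windows
    have bounded length, the errors accumulated within a window still vanish, and
    they bound the spread at the intermediate times. *)
Lemma spread_cvg0 : spread k (center Hcap k) @[k --> \oo] --> 0.
Proof.
have [e [e_ge0 e_cvg h]] := descent_error.
pose c k := center Hcap k.
have cHcap k : Hcap (c k) := center_in Hcap_closed Hcap_z0 k.
have cH k i : H i (c k) by exact: cHcap.
have run k a m : spread (a + m) (c k) <= spread a (c k)
    - \sum_(a <= l < a + m) dissipation l + \sum_(a <= l < a + m) e l.
  apply: spread_run => l; apply: h => //; exact: center_le Hcap_closed Hcap_z0 k.
pose E j := \sum_(ks j <= l < ks j.+1) e l.
have E_cvg : E j @[j --> \oo] --> 0.
  apply/cvgrPdist_le => d d0.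
  have dM : 0 < d / M.+1%:R by rewrite divr_gt0// ltr0n.
  have /cvgrPdist_le/(_ _ dM)[N _ hN] := e_cvg.
  exists N => // j /= Nj.
  rewrite sub0r normrN ger0_norm ?sumr_ge0//.
  apply: (@le_trans _ _ (\sum_(ks j <= l < ks j.+1) d / M.+1%:R)).
    apply: ler_sum_nat => l /andP[jl _].
    have /= := hN l (leq_trans (leq_trans Nj (ks_ge j)) jl).
    by rewrite sub0r normrN ger0_norm.
  rewrite sumr_const_nat -[_ *+ _]mulr_natl mulrCA ger_pMr//.
  rewrite ler_pdivrMr ?ltr0n// mul1r ler_nat ltnW// ltnS.
  by have /andP[] := ks_gap j.
have ksE j : ks j.+1 = (ks j + (ks j.+1 - ks j))%N.
  by rewrite subnKC// ltnW// ks_lt.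
pose D j := \sum_(ks j <= l < ks j.+1) dissipation l.
have D0 j : 0 <= D j by apply: sumr_ge0 => l _; exact: dissipation_ge0.
pose u j := spread (ks j) (c (ks j)).
have u_next j : u j.+1 <= u j - D j + E j.
  have := run (ks j) (ks j) (ks j.+1 - ks j)%N; rewrite -ksE; apply: le_trans.
  exact: (spread_center Hcap_closed Hcap_z0 (ks j.+1) (cHcap (ks j))).
have u_cvg : u j @[j --> \oo] --> 0.
  apply: (@descent_cvg0 _ u E (fun=> 1)) => //.
  - by move=> j; exact: spread_ge0.
  - by move=> j; apply: le_trans (u_next j) _; rewrite lerD2r gerBl.
  - move=> N B; exists (Num.truncn B).+1.
    by rewrite sumr_const_nat addKn ltW// truncnS_gt.
  - move=> d d0; have d20 : 0 < d / 2 by rewrite divr_gt0.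
    have dd : d / 2 < d by rewrite ltr_pdivrMr// ltr_pMr// ltr1n.
    have [c1 c10 small] := small_dissipation d20.
    exists (c1 / 2); first by rewrite divr_gt0.
    have c120 : 0 < c1 / 2 by rewrite divr_gt0.
    have E_le : \forall j \near \oo, E j <= c1 / 2.
      by have /cvgr_le := E_cvg; apply.
    near=> j => uj; rewrite mulr1.
    have Ej : E j <= c1 / 2 by near: j.
    have : D j <= c1 -> u j <= d / 2 by near: j.
    have [Dj /(_ isT) uj2|Dj _] := leP (D j) c1.
      by have := lt_le_trans dd (le_trans uj uj2); rewrite ltxx.
    apply: le_trans (u_next j) _; rewrite -addrA lerD2l.
    have -> : - (c1 / 2) = - c1 + c1 / 2 by field.
    by rewrite lerD// lerN2 ltW.
apply/cvgrPdist_le => d d0; have d20 : 0 < d / 2 by rewrite divr_gt0.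
have [J _ hJ] : \forall j \near \oo, u j <= d / 2 /\ E j <= d / 2.
  by apply: filterI; [have /cvgr_le := u_cvg|have /cvgr_le := E_cvg]; apply.
exists (ks J) => // k /= Jk.
have [j [Jj /andP[jk kj]]] : exists j, (J <= j)%N /\ (ks j <= k < ks j.+1)%N.
  elim: k Jk => [|k IH] Jk.
    by exists J; split => //; rewrite Jk (leq_ltn_trans (leq0n (ks J))) ?ks_lt.
  have [Jk1|Jk1] := leqP (ks J) k; last first.
    have <- : ks J = k.+1 by apply/eqP; rewrite eqn_leq Jk Jk1.
    by exists J; split=> //; rewrite leqnn ks_lt.
  have [j [Jj /andP[jk kj]]] := IH Jk1.
  have [kj1|kj1] := ltnP k.+1 (ks j.+1).
    by exists j; rewrite (leqW jk) kj1.
  have <- : ks j.+1 = k.+1 by apply/eqP; rewrite eqn_leq kj kj1.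
  by exists j.+1; split; [exact: leqW|rewrite leqnn ks_lt].
have [uj Ej] := hJ j Jj.
rewrite sub0r normrN ger0_norm ?spread_ge0//.
apply: (@le_trans _ _ (spread k (c (ks j)))).
  exact: (spread_center Hcap_closed Hcap_z0 k (cHcap (ks j))).
have run_k := run (ks j) (ks j) (k - ks j)%N; rewrite subnKC// in run_k.
have e_le : \sum_(ks j <= l < k) e l <= E j.
  by rewrite /E (@big_cat_nat _ _ _ k _ (ks j.+1))//= ?lerDl ?sumr_ge0// ltnW.
have d_ge0 : 0 <= \sum_(ks j <= l < k) dissipation l.
  by apply: sumr_ge0 => l _; exact: dissipation_ge0.
apply: le_trans run_k _; rewrite [leRHS]splitr lerD ?(le_trans e_le)//.
by rewrite (le_trans _ uj)// gerBl.
Unshelve. all: by end_near. Qed.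

(** One vanishing quantity that bounds both the disagreement of the agents and
    the infeasibility of their average. *)
Definition gap k : R := Num.sqrt (spread k (center Hcap k)).

Lemma gap_cvg0 : gap k @[k --> \oo] --> 0.
Proof.
rewrite -(@sqrtr0 R).
by apply: continuous_cvg; [exact: sqrt_continuous|exact: spread_cvg0].
Qed.

Lemma gap_ge0 k : 0 <= gap k.
Proof. exact: sqrtr_ge0. Qed.

Lemma sqr_gap k : gap k ^+ 2 = spread k (center Hcap k).
Proof. by rewrite sqr_sqrtr ?spread_ge0. Qed.

Lemma disagreement_le_gap k :
  \sum_i enorm (x k i - average (x k)) ^+ 2 <= gap k ^+ 2.
Proof. by rewrite sqr_gap spread_average lerDr mulr_ge0 ?sqr_ge0. Qed.

Lemma dist_average_le_gap k i : enorm (x k i - average (x k)) <= gap k.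
Proof.
rewrite -ler_sqr ?nnegrE ?enorm_ge0 ?gap_ge0//.
apply: le_trans (disagreement_le_gap k).
by rewrite (bigD1 i)//= lerDl sumr_ge0// => j _; exact: sqr_ge0.
Qed.

Lemma dist_Hcap_le_gap k : enorm (average (x k) - center Hcap k) <= gap k.
Proof.
rewrite -ler_sqr ?nnegrE ?enorm_ge0 ?gap_ge0// sqr_gap spread_average.
rewrite ler_wpDr ?sumr_ge0// => [i _|]; first exact: sqr_ge0.
by rewrite ler_peMl ?sqr_ge0// ler1n.
Qed.

Lemma mix_average_le_gap k i : enorm (v k i - average (x k)) <= gap k.
Proof. by apply: mix_le; [exact: gap_ge0|exact: dist_average_le_gap]. Qed.

Lemma consensus_cvg i : x k i - average (x k) @[k --> \oo] --> (0 : 'rV[R]_r).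
Proof.
apply/cvgrPdist_le => d d0; near=> k; rewrite sub0r normrN.
rewrite (le_trans (le_norm_enorm _))// (le_trans (dist_average_le_gap _ _))//.
by near: k; have /cvgr_le := gap_cvg0; apply.
Unshelve. all: by end_near. Qed.

(** The increments of the [q k i] depend on the agents only through their norms,
    and do so in a Lipschitz way. *)
Lemma gain_diff_cvg0 i j : gain k i - gain k j @[k --> \oo] --> 0.
Proof.
apply/cvgrPdist_le => d d0; near=> k; rewrite sub0r normrN.
rewrite /gain -mulrBl normrM (gtr0_norm T_gt0) -ler_pdivlMr//.
apply: le_trans (atan_expR_lipschitz _ _) _.
apply: le_trans (enorm_dist _ _) _.
apply: le_trans (enorm_trans (average (x k)) _ _) _.
rewrite (enormB (average _)) (le_trans (lerD (dist_average_le_gap _ _)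
  (dist_average_le_gap _ _)))//.
rewrite -mulr2n -[_ *+ 2]mulr_natl -ler_pdivlMl//.
near: k; have /cvgr_le := gap_cvg0; apply.
by rewrite !mulr_gt0// ?invr_gt0.
Unshelve. all: by end_near. Qed.

(** * Optimality *)

Section Optimality.
Hypothesis z0_min : forall t, Hcap t -> \sum_i f i z0 <= \sum_i f i t.

Local Notation F := (fun s => \sum_i f i s).
Local Notation X := (minimizers F Hcap).
Let i0 := Ordinal n_gt0.
(** The step of one arbitrary agent, to which all others are compared. *)
Definition ref_step k : R := (Num.sqrt (q k i0))^-1.
Definition step_ratio k i : R := alpha k i / ref_step k.

Lemma ref_step_gt0 k : 0 < ref_step k.
Proof. by rewrite invr_gt0 sqrtr_gt0 q_gt0. Qed.

Lemma F_continuous : continuous F.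
Proof.
by move=> p; apply: (cvg_sum (F := nbhs p)) => i; exact: differentiable_continuous.
Qed.

Lemma X_closed : closed X.
Proof. exact: minimizers_closed Hcap_closed F_continuous. Qed.

Lemma X_z0 : X z0.
Proof. by split; [exact: Hcap_z0|exact: z0_min]. Qed.

Lemma le_double_b (t : R) : t <= b -> t <= 2 * b.
Proof. by move: b_ge0; lra. Qed.

Lemma mix_z0_le k i : enorm (v k i - z0) <= b.
Proof. exact: mix_le. Qed.

(** On a bounded trajectory the gradients are bounded, so the switch eventually
    always selects [1 / sqrt (q k i)]. *)
Lemma step_ratio_cvg1 i : step_ratio k i @[k --> \oo] --> (1 : R).
Proof.
have gk k : pi / 4 * T <= gain k i by have /andP[] := gain_bounds k i.
have q_ratio := gain_ratio_cvg1 gain_lb_gt0 (ltW (q0_gt0 i)) (q_next^~ i0)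
  (q_next^~ i) gk (gain_diff_cvg0 i0 i).
have : Num.sqrt (q k i0 / q k i) @[k --> \oo] --> (1 : R).
  by rewrite -(@sqrtr1 R); apply: continuous_cvg; [exact: sqrt_continuous|].
apply: cvg_trans; apply: near_eq_cvg.
have [L hL] := grad_bound; have [L0 gL] := hL i.
have small : \forall k \near \oo, (Num.sqrt (q k i))^-1 <= (L i ^+ 2 + 1)^-1.
  have /cvgr_le := invsqrt_gain_cvg0 gain_lb_gt0 (ltW (q0_gt0 i)) (q_next^~ i) gk.
  by apply; rewrite invr_gt0 ltr_wpDl ?sqr_ge0.
near=> k.
have : (Num.sqrt (q k i))^-1 <= (L i ^+ 2 + 1)^-1 by near: k.
rewrite lef_pV2 ?posrE ?sqrtr_gt0 ?q_gt0 ?ltr_wpDl ?sqr_ge0// => qk.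
rewrite {1}/step_ratio; have -> : alpha k i = (Num.sqrt (q k i))^-1.
  rewrite /stepsize ifF//; apply/negbTE; rewrite -ltNge.
  apply: lt_le_trans qk; apply: (@le_lt_trans _ _ (L i ^+ 2)); last by rewrite ltrDl.
  rewrite ler_sqr ?nnegrE ?enorm_ge0 ?(ltW L0)//.
  by apply: gL; apply: le_double_b; exact: mix_z0_le.
by rewrite /ref_step invrK sqrtrM ?(ltW (q_gt0 _ _))// sqrtrV ?(ltW (q_gt0 _ _))// mulrC.
Unshelve. all: by end_near. Qed.

(** Replacing every step by [ref_step] and every mixed point by the average costs
    [err], a sum of three kinds of terms: the quadratic terms, the distance of the
    mixed point to the average, and the deviation of the step ratio from 1. The
    value of [f i] at the mixed point is compared from below only, which is what
    the gradient inequality at the average provides. *)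
Lemma optimal_descent : exists err : nat -> R,
  err k @[k --> \oo] --> 0 /\
  forall k z, (forall i, H i z) -> enorm (z - z0) <= 2 * b ->
    spread k.+1 z <=
    spread k z + ref_step k * (err k - 2 * T * (F (average (x k)) - F z)).
Proof.
have [L hL] := grad_bound.
pose C i := L i * (3 * b).
pose err1 k i := T ^+ 2 * L i ^+ 2 * (step_ratio k i * alpha k i) +
  2 * T * (L i * gap k + `|step_ratio k i - 1| * C i).
exists (fun k => \sum_i err1 k i); split.
  rewrite [X in _ --> X](_ : 0 = \sum_(i < n) (0 : R)); last by rewrite big1.
  apply: cvg_sum => i.
  rewrite [X in _ --> X](_ : 0 = T ^+ 2 * L i ^+ 2 * (1 * 0) +
    2 * T * (L i * 0 + `|1 - 1| * C i)); last by rewrite subrr normr0; ring.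
  apply: cvgD; apply: cvgMr.
    by apply: cvgM; [exact: step_ratio_cvg1|exact: alpha_cvg0].
  apply: cvgD; first by apply: cvgMr; exact: gap_cvg0.
  apply: cvgMl; apply: cvg_norm; apply: cvgB; [exact: step_ratio_cvg1|exact: cvg_cst].
move=> k z Hz zb; apply: le_trans (spread_next k Hz) _.
rewrite -addrA lerD2l -[leRHS]add0r lerD ?oppr_le0 ?dissipation_ge0//.
have -> : F (average (x k)) - F z = \sum_i (f i (average (x k)) - f i z).
  by rewrite sumrB.
rewrite mulr_sumr -sumrB mulr_sumr; apply: ler_sum => i _.
have [L0 gL] := hL i.
have alphaE : alpha k i = ref_step k * step_ratio k i.
  by rewrite /step_ratio mulrCA mulfV ?mulr1// gt_eqF// ref_step_gt0.
have gv := gL _ (le_double_b (mix_z0_le k i)).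
have ga := gL _ (le_double_b (average_z0_le k)).
have gz := gL _ zb.
have vz : enorm (v k i - z) <= 3 * b.
  have := enorm_trans z0 (v k i) z; rewrite (enormB z0 z).
  by have := mix_z0_le k i; move: zb; lra.
have fvz : `|f i (v k i) - f i z| <= C i.
  have h t p : enorm (grad (f i) t) <= L i -> enorm (p - t) <= 3 * b ->
      f i t - f i p <= C i.
    move=> gt pt; apply: le_trans (convex_drop_le p (f_diff i t) (f_convex i) gt) _.
    by rewrite ler_wpM2l// ltW.
  rewrite ler_norml lerNl opprB !h//.
  by rewrite enormB.
have fav : f i (average (x k)) - f i (v k i) <= L i * gap k.
  apply: le_trans (convex_drop_le _ (f_diff i _) (f_convex i) ga) _.
  by rewrite ler_wpM2l ?(ltW L0)// mix_average_le_gap.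
have g2 : alpha k i ^+ 2 * enorm (g k i) ^+ 2 <=
    ref_step k * step_ratio k i * alpha k i * L i ^+ 2.
  rewrite -alphaE -expr2 ler_wpM2l ?sqr_ge0//.
  by rewrite ler_sqr ?nnegrE ?enorm_ge0 ?(ltW L0).
have b2 : 0 <= 2 * T * ref_step k.
  by rewrite !mulr_ge0 ?(ltW T_gt0)// ltW// ref_step_gt0.
have hA := mulr_ge0 b2 (etrans (subr_ge0 _ _) fav).
have hB : 0 <= 2 * T * ref_step k *
    (`|step_ratio k i - 1| * C i + (step_ratio k i - 1) * (f i (v k i) - f i z)).
  rewrite mulr_ge0// -lerBlDr sub0r -mulNr.
  apply: le_trans (ler_norm _) _; rewrite normrM normrN.
  by rewrite ler_wpM2l.
have T2 : 0 <= T ^+ 2 by exact: sqr_ge0.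
have := ler_wpM2l T2 g2; move: hA hB; rewrite /err1 !alphaE.
move: (step_ratio k i) (ref_step k) (C i) (gap k) (`|_ - 1|) (f i z) (f i (v k i)).
move: (f i (average (x k))) (enorm _) => fa gn rho be Ci ga' ab fz fv.
by lra.
Qed.

(** The same descent principle, now at the optimal set and with the divergent
    weights [ref_step]. Once the agents almost agree, a spread of at least [d]
    puts the average far from the optimal set though almost feasible, so [F]
    exceeds its optimum by some [rho], and the spread drops by
    [ref_step k * (T * rho)]. *)
Lemma spread_X_cvg0 : spread k (center X k) @[k --> \oo] --> 0.
Proof.
have [e [e_ge0 e_cvg he]] := descent_error.
have [err [err_cvg herr]] := optimal_descent.
have cX k : X (center X k) := center_in X_closed X_z0 k.
have cH k i : H i (center X k) by have [+ _] := cX k; exact.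
have cle k : enorm (center X k - z0) <= 2 * b := center_le X_closed X_z0 k.
have next_center k : spread k.+1 (center X k.+1) <= spread k.+1 (center X k).
  exact: (spread_center X_closed X_z0 k.+1 (cX k)).
apply: (@descent_cvg0 _ _ e ref_step) => //.
- by move=> k; exact: spread_ge0.
- by move=> k; exact/ltW/ref_step_gt0.
- move=> k; apply: le_trans (next_center k) _.
  apply: le_trans (he k _ (cH k) (cle k)) _.
  by rewrite lerD2r gerBl dissipation_ge0.
- apply: (@invsqrt_gain_dvg _ (q^~ i0) (gain^~ i0) (pi / 2 * T)) => //.
  move=> k; have /andP[h ->] := gain_bounds k i0; rewrite andbT.
  by apply: le_trans h; exact/ltW/gain_lb_gt0.
move=> d d0.
have nR : 0 < n%:R :> R by rewrite ltr0n.
(* Disagreement takes at most [d / 2] of the spread; with the average within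
   [r0] of the optimal set the remainder would be at most [d / 4]. *)
pose r0 := Num.sqrt (d / (4 * n%:R)).
have r00 : 0 < r0 by rewrite sqrtr_gt0 divr_gt0// mulr_gt0.
have r02 : n%:R * r0 ^+ 2 = d / 4.
  by rewrite sqr_sqrtr ?divr_ge0 ?mulr_ge0 ?ltW//; field; rewrite gt_eqF.
have [rho rho0 near_X] :=
  near_minimizers z0 b Hcap_closed F_continuous X_z0 r00.
exists (T * rho); first by rewrite mulr_gt0.
have gap_rho : \forall k \near \oo, gap k <= rho.
  by have /cvgr_le := gap_cvg0; apply.
have err_rho : \forall k \near \oo, err k <= T * rho.
  by have /cvgr_le := err_cvg; apply; rewrite mulr_gt0.
have gap_r0 : \forall k \near \oo, gap k <= Num.sqrt (d / 2).
  by have /cvgr_le := gap_cvg0; apply; rewrite sqrtr_gt0 divr_gt0.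
near=> k => dk.
have gk : gap k <= rho by near: k.
have ek : err k <= T * rho by near: k.
have g2k : gap k ^+ 2 <= d / 2.
  rewrite -(@sqr_sqrtr _ (d / 2)) ?divr_ge0 ?(ltW d0)//.
  by rewrite ler_sqr ?nnegrE ?sqrtr_ge0 ?gap_ge0//; near: k.
have far : F z0 + rho < F (average (x k)).
  rewrite ltNge; apply/negP => Fle.
  have [|s Xs sk] := near_X _ (average_z0_le k) _ Fle.
    exists (center Hcap k); first exact: (center_in Hcap_closed Hcap_z0 k).
    exact: le_trans (dist_Hcap_le_gap k) gk.
  have := le_trans (center_min X_closed X_z0 k Xs) sk.
  rewrite -ler_sqr ?nnegrE ?enorm_ge0 ?(ltW r00)// => /(ler_wpM2l (ltW nR)).
  rewrite r02 => near_c; have := disagreement_le_gap k.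
  by move: dk near_c g2k d0; rewrite spread_average; lra.
apply: le_trans (next_center k) _.
apply: le_trans (herr k _ (cH k) (cle k)) _.
rewrite lerD2l.
have -> : - (T * rho * ref_step k) = ref_step k * (- (T * rho)) by ring.
rewrite ler_wpM2l ?(ltW (ref_step_gt0 k))//.
have Fc : F (center X k) <= F z0 by have [_] := cX k; apply; exact: Hcap_z0.
have : 0 <= T * (F (average (x k)) - F (center X k) - rho).
  by rewrite mulr_ge0 ?(ltW T_gt0)//; move: far Fc; lra.
by move: ek; lra.
Unshelve. all: by end_near. Qed.

Lemma dist_X_cvg0 i :
  enorm (x k i - center X k) @[k --> \oo] --> (0 : R).
Proof.
have h : Num.sqrt (spread k (center X k)) @[k --> \oo] --> (0 : R).
  rewrite -[X in _ --> X](@sqrtr0 R).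
  apply: continuous_cvg; first exact: sqrt_continuous.
  exact: spread_X_cvg0.
apply: squeeze_cvgr (cvg_cst 0) h; near=> k; rewrite enorm_ge0/=.
rewrite -[leLHS]ger0_norm ?enorm_ge0// -sqrtr_sqr ler_wsqrtr//.
exact: dist_le_spread.
Unshelve. all: by end_near. Qed.

End Optimality.

End Consensus.

End Bounded.

End Trajectory.

Theorem theorem3 (R : realType) (n r : nat)
    (f : 'I_n -> 'rV[R]_r -> R) (H : 'I_n -> set 'rV[R]_r)
    (A : nat -> 'M[R]_n) (T : R) (gamma : 'I_n -> R)
    (x : nat -> 'I_n -> 'rV[R]_r) (q : nat -> 'I_n -> R)
    (f_diff : forall i p, differentiable (f i) p)
    (f_convex : forall i, convex_function [set: 'rV[R]_r] (f i))
    (H_closed : forall i, closed (H i))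
    (H_convex : forall i, convex_set (H i))
    (A_ge0 : forall k i j, 0 <= A k i j)
    (T_gt0 : 0 < T)
    (crit_neq0 : forall i, [set p | grad (f i) p = 0] !=set0)
    (crit_bounded : forall i, bounded_set [set p | grad (f i) p = 0])
    (H_neq0 : \bigcap_i H i !=set0)
    (weights : exists eta : R, [/\ 0 < eta, eta <= 1 &
      forall k,
        [/\ forall i, eta <= A k i i,
            forall i j, A k i j <> 0 -> eta <= A k i j,
            forall j, \sum_(i < n) A k i j = 1 &
            forall i, \sum_(j < n) A k i j = 1]])
    (connectivity : exists (M : nat) (ks : nat -> nat),
      [/\ (0 < M)%N, ks 0%N = 0%N,
          forall j, (0 < ks j.+1 - ks j <= M)%N &
          forall j, strongly_connected
            (union_graph (fun k => digraph (A k)) (ks j) (ks j.+1))])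
    (gamma_bounds : forall i, 0 < gamma i < 1)
    (q0_gt0 : forall i, 0 < q 0%N i)
    (x_next : forall k i,
      x k.+1 i = next_x f H T gamma (A k) (x k) (q k) i)
    (q_next : forall k i, q k.+1 i = next_q T (x k) (q k) i) :
  let X := minimizers (fun s => \sum_(i < n) f i s) (\bigcap_i H i) in
  (forall i, (fun k => x k i - average (x k)) @ \oo --> (0 : 'rV[R]_r)) /\
  (forall i, (fun k => enorm (x k i - nearest_point X (average (x k)))) @ \oo
               --> (0 : R)).

Proof.
move=> X; have [eta [eta0 eta1 wA]] := weights.
have [M [ks [M0 ks0 ks_gap ks_conn]]] := connectivity.
have A_diag k i : eta <= A k i i by have [h _ _ _] := wA k; exact: h.
have A_edge k i j : 0 < A k i j -> eta <= A k i j.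
  by have [_ h _ _] := wA k => Aij; apply: h => A0; rewrite A0 ltxx in Aij.
have A_col k j : \sum_i A k i j = 1 by have [_ _ h _] := wA k; exact: h.
have A_row k i : \sum_j A k i j = 1 by have [_ _ _ h] := wA k; exact: h.
have clH : closed (\bigcap_i H i) by exact: closed_bigI.
(* Both conclusions are about an agent, whose existence gives [0 < n]. *)
suff main : (0 < n)%N -> forall i,
    (fun k => x k i - average (x k)) @ \oo --> (0 : 'rV[R]_r) /\
    (fun k => enorm (x k i - nearest_point X (average (x k)))) @ \oo
      --> (0 : R).
  by split=> i; have [] := main (leq_ltn_trans (leq0n i) (ltn_ord i)) i.
move=> n0 i.
(* Taking an optimal point as the reference feasible point makes one bound on
   the trajectory serve for both the feasible and the optimal set. *)
have [z0 [Hz0 z0_min]] := minimizer_exists n0 f_diff f_convex crit_neq0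
  crit_bounded clH H_neq0.
have Hz0i j : H j z0 by exact: Hz0.
have [b b0 xb] := trajectory_bounded f_diff f_convex H_closed H_convex A_ge0
  A_row T_gt0 gamma_bounds crit_neq0 crit_bounded q0_gt0 x_next q_next Hz0i.
split.
  exact: (consensus_cvg f_diff f_convex H_closed H_convex A_ge0 A_row A_col
    T_gt0 gamma_bounds q0_gt0 x_next q_next n0 Hz0i b0 xb eta0
    A_diag A_edge ks_gap ks_conn).
exact: (dist_X_cvg0 f_diff f_convex H_closed H_convex A_ge0 A_row A_col
  T_gt0 gamma_bounds q0_gt0 x_next q_next n0 Hz0i b0 xb eta0
  A_diag A_edge ks_gap ks_conn z0_min).
Qed.
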